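(* Let $T>0$, $d\in\mathbb N$, $\gamma>-\min\{2,d\}$, $\alpha>\max\{1,1+\frac{\gamma}{d}\}$, $\alpha\le q<\infty$, $\frac{\gamma}{\alpha-1}\le s<d$. Assume that $\alpha<\alpha^*$, $\alpha<r\le\infty$ and $\frac sd+\frac1q=\frac1{Q_c}<\frac1{q_c}$. Let $u_0\in L^{q,r}_s(\mathbb R^d)$. If $u_1,u_2\in L^\infty(0,T;L^{q,r}_s(\mathbb R^d))$ are mild solutions to the Hardy–Hénon equation with $u_1(0)=u_2(0)=u_0$ such that $$u_i(t)-e^{t\Delta}u_0\in L^\infty(0,T;L^{q,r'(\alpha-1)}_s(\mathbb R^d))\quad\text{for } i=1,2,$$ where $r'$ is the Hölder conjugate of $r$ ($1=\frac1r+\frac1{r'}$), then $u_1=u_2$ on $[0,T]$.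
   Context: Weighted Lorentz spaces. For a measurable function $f$ on $\mathbb R^d$ let $d_f(\lambda)=|\{x:|f(x)|>\lambda\}|$ and $f^*(t)=\inf\{\lambda>0: d_f(\lambda)\le t\}$. For $0<q,r\le\infty$, $\|f\|_{L^{q,r}}=\big(\int_0^\infty (t^{1/q}f^*(t))^r\frac{dt}{t}\big)^{1/r}$ if $r<\infty$, and $\|f\|_{L^{q,\infty}}=\sup_{t>0}t^{1/q}f^*(t)$. For $s\in\mathbb R$, $L^{q,r}_s(\mathbb R^d)$ is the space of measurable $f$ with $\|f\|_{L^{q,r}_s}:=\||\cdot|^sf\|_{L^{q,r}}<\infty$. Convention: $1/\infty=0$. $L^\infty(0,T;X)$ is the space of functions $u:(0,T)\to X$ with $\mathrm{ess\,sup}_{t\in(0,T)}\|u(t)\|_X<\infty$. Exponents: $q_c=\frac{d(\alpha-1)}{2+\gamma}$, $Q_c=\frac{d\alpha}{d+\gamma}$, and $\alpha^*=\frac{d+\gamma}{d-2}$ if $d\ge3$, $\alpha^*=\infty$ if $d=1,2$. Equation: $\partial_tu-\Delta u=|x|^\gamma|u|^{\alpha-1}u$ on $(0,T)\times\mathbb R^d$, $u(0)=u_0$, for complex-valued $u$. A mild solution in $L^\infty(0,T;X)$ with initial data $u_0\in X$ is a function $u\in L^\infty(0,T;X)$ satisfying, for almost every $(t,x)\in(0,T)\times\mathbb R^d$, $$u(t)=e^{t\Delta}u_0+\int_0^te^{(t-\tau)\Delta}\big(|\cdot|^\gamma|u(\tau)|^{\alpha-1}u(\tau)\big)\,d\tau,$$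 where $e^{t\Delta}f=G_t*f$, $G_t(x)=(4\pi t)^{-d/2}e^{-|x|^2/(4t)}$. *)

(* Defs.v *)
From HB Require Import structures.
From mathcomp Require Import all_boot all_order all_algebra.
From mathcomp Require Import complex.
From mathcomp Require Import all_classical all_reals all_analysis.
From mathcomp Require Import ess_sup_inf.

Set Implicit Arguments.
Unset Strict Implicit.
Unset Printing Implicit Defensive.

Import Order.TTheory GRing.Theory Num.Theory.
Import numFieldNormedType.Exports.
Import ComplexField.Normc.

Local Open Scope classical_set_scope.
Local Open Scope ring_scope.

(* R^d with its Borel sigma-algebra (the product one carried by tuples). *)
Notation euclid R d := (d.-tuple (measurableTypeR R)).

Section lebesgue_tuple.
Context {R : realType}.

Definition cons_euclid n (z : measurableTypeR R * euclid R n) : euclid R n.+1 :=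
  [the n.+1.-tuple _ of z.1 :: z.2].

Lemma measurable_cons_euclid n : measurable_fun [set: _] (@cons_euclid n).
Proof. exact: measurable_cons. Qed.

Section step.
Variables (n : nat) (m : {sigma_finite_measure set (euclid R n) -> \bar R}).

Definition lebesgue_cons : set (euclid R n.+1) -> \bar R :=
  pushforward (@lebesgue_measure R \x m)%E (@cons_euclid n).

Let pushm : {measure set (euclid R n.+1) -> \bar R} :=
  measure_function_pushforward__canonical__measure_function_Measure
    (@lebesgue_measure R \x m)%E (@measurable_cons_euclid n).

HB.instance Definition _ := isMeasure.Build _ _ _ lebesgue_cons
  (measure0 pushm) (measure_ge0 pushm) (@measure_semi_sigma_additive _ _ _ pushm).

Lemma lebesgue_cons_box (A : set R) (B : set (euclid R n)) :
    measurable (A : set (measurableTypeR R)) -> measurable B ->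
  lebesgue_cons [set x | A (thead x) /\ B [tuple of behead x]]
  = (lebesgue_measure A * m B)%E.
Proof.
move=> mA mB; rewrite -product_measure1E//; congr product_measure1.
have beheadE x (y : euclid R n) : [tuple of behead (cons_euclid (x, y))] = y.
  exact: val_inj.
apply/seteqP; split=> -[x y] /=; rewrite theadE beheadE => -[]//.
Qed.

Lemma measurable_thead : measurable_fun [set: euclid R n.+1] (@thead n R).
Proof. exact: measurable_tnth. Qed.

Let lebesgue_cons_sigma_finite : sigma_finite setT lebesgue_cons.
Proof.
have /sigma_finiteP[F [TF ndF Foo]] := sigma_finiteT (@lebesgue_measure R).
have /sigma_finiteP[G [TG ndG Goo]] := sigma_finiteT m.
exists (fun k => [set x | F k (thead x) /\ G k [tuple of behead x]]).
  apply/seteqP; split=> // x _.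
  have [i _ Fi] : (\bigcup_i F i) (thead x) by rewrite -TF.
  have [j _ Gj] : (\bigcup_i G i) [tuple of behead x] by rewrite -TG.
  exists (maxn i j) => //; split.
    by move: Fi; exact/subsetPset/ndF/leq_maxl.
  by move: Gj; exact/subsetPset/ndG/leq_maxr.
move=> k; have [mF Fk] := Foo k; have [mG Gk] := Goo k; split.
  apply: measurableI.
    by rewrite -[X in measurable X]setTI; exact: measurable_thead.
  by rewrite -[X in measurable X]setTI; exact: measurable_behead.
by rewrite lebesgue_cons_box// lte_mul_pinfty// ge0_fin_numE.
Qed.

HB.instance Definition _ := Measure_isSigmaFinite.Build _ _ _ lebesgue_cons
  lebesgue_cons_sigma_finite.

End step.

Fixpoint lebesgue_euclid (d : nat) :
    {sigma_finite_measure set (euclid R d) -> \bar R} :=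
  match d return {sigma_finite_measure set (euclid R d) -> \bar R} with
  | 0 => [the {sigma_finite_measure set _ -> \bar R} of
           dirac ([tuple] : euclid R 0)]
  | n.+1 => [the {sigma_finite_measure set _ -> \bar R} of
             lebesgue_cons (lebesgue_euclid n)]
  end.

Let inord_lift0 d (i : 'I_d) : inord i.+1 = lift ord0 i :> 'I_d.+1.
Proof. by apply/val_inj; rewrite /= inordK// ltnS. Qed.

Lemma lebesgue_euclid_box d (A : 'I_d -> set R) :
    (forall i, measurable (A i : set (measurableTypeR R))) ->
  lebesgue_euclid d [set x | forall i, A i (tnth x i)]
  = (\big[*%E/1%E]_(i < d) lebesgue_measure (A i))%E.
Proof.
elim: d A => [|d IH] A mA.
  by rewrite big_ord0 /= diracE mem_set//=; case.
rewrite big_ord_recl -(IH (fun i => A (lift ord0 i)))//=.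
rewrite -lebesgue_cons_box//; last first.
  rewrite (_ : mkset _ =
      \bigcap_i [set x : euclid R d | A (lift ord0 i) (tnth x i)]).
    apply: fin_bigcap_measurable => // i _; rewrite -[X in measurable X]setTI.
    exact: (@measurable_tnth _ (measurableTypeR R) d i).
  by apply/seteqP; split=> [x h i _|x h i]; exact: h.
congr (lebesgue_cons _ _); apply/seteqP; split=> x /= h.
  split; first exact: h.
  by move=> i; rewrite tnth_behead inord_lift0.
case: h => h0 h i; case: (unliftP ord0 i) => [j ->|->//].
by move: (h j); rewrite tnth_behead inord_lift0.
Qed.

End lebesgue_tuple.

Section complex_integral.
Context d (X : measurableType d) (R : realType).
Implicit Types (D : set X) (f : X -> R[i]).

Definition cmeasurable D f :=
  measurable_fun D (@complex.Re R \o f) /\ measurable_fun D (@complex.Im R \o f).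

Variable mu : {measure set X -> \bar R}.

Definition cintegrable D f :=
  mu.-integrable D (EFin \o (@complex.Re R \o f)) /\
  mu.-integrable D (EFin \o (@complex.Im R \o f)).

Definition cintegral D f : R[i] :=
  (\int[mu]_(x in D) complex.Re (f x) +i* \int[mu]_(x in D) complex.Im (f x))%C.

End complex_integral.

Section lorentz.
Local Open Scope ereal_scope.
Context d (X : measurableType d) (R : realType).
Variable mu : {measure set X -> \bar R}.
Implicit Types (q r : \bar R) (f : X -> R[i]).

Definition distrib_fun f (lam : R) : \bar R :=
  mu [set x | (lam < normc (f x))%R].

Definition rearrangement f (t : R) : \bar R :=
  ereal_inf [set lam%:E | lam in
    [set lam | (0 < lam)%R /\ distrib_fun f lam <= t%:E]].

(* [inve] satisfies [+oo^-1 = 0]; only 0 < q and 0 < r are meaningful. *)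
Definition lorentz_norm q r f : \bar R :=
  let g t := (t `^ fine q^-1)%R%:E * rearrangement f t in
  match r with
  | r0%:E => (\int[@lebesgue_measure R]_(t in `]0%R, +oo[)
                (g t `^ r0 * (t^-1)%R%:E)) `^ (r0^-1)%R
  | _ => ereal_sup [set g t | t in `]0%R, +oo[]
  end.

End lorentz.

Section weighted_lorentz.
Context (R : realType) (d : nat).
Implicit Types (s T : R) (q r : \bar R) (f : euclid R d -> R[i]).

Definition enorm (x : euclid R d) : R := Num.sqrt (\sum_(i < d) tnth x i ^+ 2).

Definition wlorentz_norm s q r f : \bar R :=
  lorentz_norm (lebesgue_euclid d) q r (fun x => (enorm x `^ s)%:C%C * f x).

Definition wlorentz s q r f :=
  cmeasurable setT f /\ (wlorentz_norm s q r f < +oo)%E.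

(* Members of L^oo(0, T; X) are functions of time up to a.e. equality, given
   here by a jointly measurable representative on ]0, T[ x R^d. *)
Definition Linfty_wlorentz T s q r (u : R -> euclid R d -> R[i]) :=
  [/\ cmeasurable (`]0, T[ `*` setT)
        (fun z : measurableTypeR R * euclid R d => u z.1 z.2),
      \forall t \ae @lebesgue_measure R, t \in `]0, T[ -> wlorentz s q r (u t)
    & (ess_sup (mrestr (@lebesgue_measure R) (measurable_itv `]0%R, T[))
         (fun t => wlorentz_norm s q r (u t)) < +oo)%E].

End weighted_lorentz.

Section hardy_henon.
Context (R : realType) (d : nat).
Implicit Types (x y : euclid R d) (f : euclid R d -> R[i])
  (u : R -> euclid R d -> R[i]).

Definition heat_kernel (t : R) x : R :=
  (4 * pi * t) `^ (- (d%:R / 2)) * expR (- enorm x ^+ 2 / (4 * t)).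

Definition heat_integrand (t : R) f x y : R[i] :=
  (heat_kernel t [tuple tnth x i - tnth y i | i < d])%:C%C * f y.

Definition heat (t : R) f x : R[i] :=
  cintegral (lebesgue_euclid d) setT (heat_integrand t f x).

Definition heat_defined (t : R) f x :=
  cintegrable (lebesgue_euclid d) setT (heat_integrand t f x).

Definition nonlinearity (gamma alpha : R) f x : R[i] :=
  (enorm x `^ gamma * normc (f x) `^ (alpha - 1))%:C%C * f x.

Definition duhamel (gamma alpha : R) u (t : R) x : R[i] :=
  cintegral (@lebesgue_measure R) `]0, t[
    (fun tau => heat (t - tau) (nonlinearity gamma alpha (u tau)) x).

Definition duhamel_defined (gamma alpha : R) u (t : R) x :=
  (\forall tau \ae @lebesgue_measure R, tau \in `]0, t[ ->
     heat_defined (t - tau) (nonlinearity gamma alpha (u tau)) x) /\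
  cintegrable (@lebesgue_measure R) `]0, t[
    (fun tau => heat (t - tau) (nonlinearity gamma alpha (u tau)) x).

(* The library integrals are total; the [_defined] clauses state that the
   integrals in the mild formulation converge absolutely. *)
Definition mild_solution (gamma alpha T s : R) (q r : \bar R)
    (u0 : euclid R d -> R[i]) u :=
  Linfty_wlorentz T s q r u /\
  \forall z \ae (@lebesgue_measure R \x lebesgue_euclid d)%E, z.1 \in `]0, T[ ->
    [/\ heat_defined z.1 u0 z.2,
        duhamel_defined gamma alpha u z.1 z.2
      & u z.1 z.2 = heat z.1 u0 z.2 + duhamel gamma alpha u z.1 z.2].

End hardy_henon.

Section exponents.
Context (R : realType).

Definition q_crit (d : nat) (gamma alpha : R) : R :=
  d%:R * (alpha - 1) / (2 + gamma).

Definition Q_crit (d : nat) (gamma alpha : R) : R :=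
  d%:R * alpha / (d%:R + gamma).

Definition alpha_star (d : nat) (gamma : R) : \bar R :=
  if (3 <= d)%N then ((d%:R + gamma) / (d%:R - 2))%:E else +oo%E.

End exponents.

(* Main.v *)
(* Put F = |x|^gamma ||u1|^(alpha-1) u1 - |u2|^(alpha-1) u2| and
   V = |x|^gamma (|u1|^(alpha-1) + |u2|^(alpha-1)), so that F <= C V |u1 - u2| and, by
   Duhamel, |u1 - u2| is at most a multiple of the space-time convolution of F with the
   heat kernel.  By scaling V(t) is bounded in weak L^p with 1/p = 1 - 1/Q_c, hence
   (V(t) * G_th)(y) <= C th^(-a) with a = d/2 (1 - 1/Q_c), and a < 1 by subcriticality.
   A Schur test with the weight exp(- Lam t - |x|_1) therefore bounds the weighted
   integral J of F by J/2 for large Lam, and F = 0 as soon as J is finite.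

   For the finiteness of J write u = h + v with h = e^(t Laplacian) u0.  Since r > alpha,
   r' (alpha - 1) < alpha, so |x|^s v lies in L^(q,alpha) and |x|^gamma |v|^alpha is
   integrable by the endpoint Hoelder inequality.  As h = u - v, |x|^s h(t) is bounded in
   weak L^q, which makes |x|^gamma |h|^(alpha-eps) locally integrable; the missing factor
   |h|^eps costs only t^(- k eps), with k eps < 1, by any polynomial-in-1/t sup bound on h. *)
From HB Require Import structures.
Require Import Defs.
From mathcomp Require Import all_boot all_order all_algebra.
From mathcomp Require Import complex.
From mathcomp Require Import all_classical all_reals all_analysis.
From mathcomp Require Import measurable_realfun ess_sup_inf ring lra.

Set Implicit Arguments.
Unset Strict Implicit.
Unset Printing Implicit Defensive.

Import Order.TTheory GRing.Theory Num.Theory.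
Import numFieldNormedType.Exports.
Import ComplexField.Normc.

Local Open Scope classical_set_scope.
Local Open Scope ring_scope.

(** * Weak Lebesgue spaces *)

(** The scaling relation says (s alpha - gamma)/d + alpha/q = 1, which is the endpoint for local
    integrability of |x|^gamma |u|^alpha. There Hoelder's inequality in Lorentz spaces yields L^1
    only for a second index at most alpha, while [r] is larger; so the nonlinearity of u cannot be
    put into L^1 directly, and the hypothesis on u - h has to close the gap. The potential V does
    not see this obstacle, since a weak-type bound is all that is asked of it. The unknown is F
    rather than u1 - u2 because F is measured in a weighted L^1 space, where Tonelli moves the whole
    estimate onto the kernel and V. The spatial weight has to compensate for the infinite volume and
    yet tolerate the kernel: passing from x to y costs exp |x - y|_1, which a Gaussian absorbs at
    the price of doubling its time. All weak-type bounds are exploited by one device, a truncation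
    at a level [L] that each use chooses for itself. In [weak_type] the constant [K] is the p-th
    power of the usual quasi-norm, so that measures of sets add up without roots. *)

Definition weak_type d (X : measurableType d) (R : realType)
    (mu : set X -> \bar R) (p K : R) (F : X -> R) : Prop :=
  forall lam, 0 < lam ->
    (mu [set x | (lam < F x)%R] <= (K * lam `^ (- p))%:E)%E.

Lemma powR_negE (R : realType) (p a : R) : 0 < a -> a `^ (- p) = a `^ (1 - p) / a.
Proof.
move=> a0; rewrite -[X in _ / X]powRr1 ?ltW// -powRB ?(gt_eqF a0) ?implybT//.
by congr (_ `^ _); ring.
Qed.

Lemma ltr_powR_neg (R : realType) (m a b : R) : 0 < m -> 0 < a -> a < b ->
  b `^ (- m) < a `^ (- m).
Proof.
move=> m0 a0 ab; have b0 := lt_trans a0 ab.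
rewrite !powRN ltf_pV2 ?posrE ?powR_gt0//.
by apply: gt0_ltr_powR => //; rewrite nnegrE ltW.
Qed.

Lemma ltr_powR_neg_inv (R : realType) (c a l : R) : 0 < c -> 0 < a -> 0 < l ->
  l < a `^ (- c) -> a < l `^ (- c^-1).
Proof.
move=> c0 a0 l0 la.
have <- : (a `^ (- c)) `^ (- c^-1) = a.
  by rewrite -powRrM mulrNN mulfV ?gt_eqF// powRr1// ltW.
by apply: ltr_powR_neg => //; rewrite invr_gt0.
Qed.

Section weak_type_theory.
Context d (X : measurableType d) (R : realType).
Variable mu : {measure set X -> \bar R}.
Implicit Types (F k : X -> R) (p K L : R).

(** Sum over j of 2^(j+1) 2^(-jp), the dyadic series in [weak_type_integral]; it converges because p
    > 1. *)
Definition weak_const p : R := 2 / (1 - 2 `^ (1 - p)).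

Lemma weak_const_ge0 p : 1 < p -> 0 <= weak_const p.
Proof.
move=> p1; rewrite /weak_const divr_ge0// subr_ge0 ltW//.
rewrite /powR pnatr_eq0/= expR_lt1 pmulr_llt0 ?subr_lt0//.
by rewrite ln_gt0// ltr1n.
Qed.

Lemma exists_dyadic (a L : R) : 0 < L -> L < a ->
  exists j : nat, 2 ^+ j * L < a /\ a <= 2 ^+ j.+1 * L.
Proof.
move=> L0 La.
have : exists n, a <= 2 ^+ n * L.
  exists (Num.bound (a / L)).
  rewrite -ler_pdivrMr//.
  have aL0 : 0 <= a / L by rewrite divr_ge0// ltW// (lt_trans L0 La).
  rewrite (le_trans (ltW (archi_boundP aL0)))// -natrX ler_nat.
  by rewrite ltnW// ltn_expl.
move=> exn; case: (ex_minnP exn) => -[|m] am min_m.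
  by move: am; rewrite expr0 mul1r leNgt La.
by exists m; split => //; rewrite ltNge; apply/negP => /min_m; rewrite ltnn.
Qed.

Lemma measurable_gt_fun F lam : measurable_fun setT F ->
  measurable [set x | lam < F x].
Proof.
move=> mF; have := mF measurableT `]lam, +oo[%classic (measurable_itv _).
rewrite setTI (_ : F @^-1` _ = [set x | lam < F x])//.
by apply/seteqP; split => x /=; rewrite in_itv/= andbT.
Qed.

Lemma geometric_nneseries (a z : R) : 0 <= a -> 0 <= z -> z < 1 ->
  (\sum_(0 <= j <oo) (a * z ^+ j)%:E = (a / (1 - z))%:E)%E.
Proof.
move=> a0 z0 z1; apply/cvg_lim => //.
have z1' : `|z| < 1 by rewrite ger0_norm.
have h := @cvg_geometric_series R a z z1'.
rewrite (_ : (fun n => _) = EFin \o series (geometric a z)).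
  by apply: cvg_EFin => //; exact: nearW.
by apply/funext => n /=; rewrite sumEFin.
Qed.

(** Below the level [L], F is at most [L]; above it, F is split into dyadic layers, each estimated
    by the weak-type bound and by k <= 1. The level stays free: it is taken to be 1 when any finite
    bound will do, and otherwise such that the two terms have the same order. *)
Lemma weak_type_integral F k p K L : 1 < p -> 0 <= K -> 0 < L ->
    measurable_fun setT F -> (forall x, 0 <= F x) ->
    measurable_fun setT k -> (forall x, 0 <= k x <= 1) ->
    weak_type mu p K F ->
  (\int[mu]_x (F x * k x)%:E <=
   L%:E * \int[mu]_x (k x)%:E + (weak_const p * K * L `^ (1 - p))%:E)%E.
Proof.
move=> p1 K0 L0 mF F0 mk k01 wF.
(* [T j] charges the upper end of the j-th dyadic layer on the whole superlevel set of its lower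
   end. Where F exceeds [L], the one layer containing the value of F already dominates it. *)
pose T j x : \bar R := ((2 ^+ j.+1 * L) * \1_[set x | (2 ^+ j * L < F x)%R] x)%:E.
have L20 j : 0 < 2 ^+ j * L :> R by rewrite mulr_gt0// exprn_gt0.
have T0 j x : (0 <= T j x)%E.
  by rewrite lee_fin mulr_ge0// ltW.
have mT j : measurable_fun [set: X] (T j).
  apply/measurable_EFinP; apply: measurable_funM => //.
  by apply: measurable_indic; exact: measurable_gt_fun.
have pt x : ((F x * k x)%:E <= L%:E * (k x)%:E + \sum_(0 <= j <oo) T j x)%E.
  have /andP[k0 k1] := k01 x.
  have [FL|LF] := leP (F x) L.
    rewrite -[leLHS]adde0 leeD ?nneseries_ge0//.
    by rewrite -EFinM lee_fin ler_wpM2r.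
  have [j [j1 j2]] := exists_dyadic L0 LF.
  apply: (@le_trans _ _ (0 + T j x)%E); last first.
    rewrite leeD//; first by rewrite -EFinM lee_fin mulr_ge0// ltW.
    rewrite (le_trans _ (nneseries_lim_ge j.+1 _))//.
    by rewrite big_nat_recr//= leeDr// sume_ge0.
  rewrite add0e /T indicE mem_set// mulr1 lee_fin (le_trans _ j2)//.
  by rewrite ler_piMr.
have mkE : measurable_fun setT (fun x => L%:E * (k x)%:E)%E.
  by apply: measurable_funeM; exact/measurable_EFinP.
have mS : measurable_fun setT (fun x => \sum_(0 <= j <oo) T j x)%E.
  by apply: ge0_emeasurable_sum => //.
apply: (@le_trans _ _ (\int[mu]_x (L%:E * (k x)%:E + \sum_(0 <= j <oo) T j x))%E).
  apply: ge0_le_integral => //.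
  - by move=> x _; rewrite lee_fin mulr_ge0//; case/andP: (k01 x).
  - by apply/measurable_EFinP; apply: measurable_funM.
  - exact: emeasurable_funD.
have k0E x : (0 <= (k x)%:E)%E by rewrite lee_fin; case/andP: (k01 x).
rewrite ge0_integralD//; last 2 first.
  by move=> x _; rewrite mule_ge0// lee_fin ltW.
  by move=> x _; rewrite nneseries_ge0.
rewrite ge0_integralZl//; last 2 first.
  exact/measurable_EFinP.
  by rewrite lee_fin ltW.
rewrite leeD2l// integral_nneseries//.
set z : R := 2 `^ (1 - p).
have z0 : 0 <= z by exact: powR_ge0.
have z1 : z < 1.
  rewrite /z /powR pnatr_eq0/= expR_lt1 pmulr_llt0 ?subr_lt0//.
  by rewrite ln_gt0// ltr1n.
have -> : weak_const p * K * L `^ (1 - p) = (2 * K * L `^ (1 - p)) / (1 - z).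
  by rewrite /weak_const -/z; ring.
rewrite -(@geometric_nneseries (2 * K * L `^ (1 - p)) z)//; last first.
  by rewrite !mulr_ge0// powR_ge0.
apply: lee_nneseries => j *; first by apply: integral_ge0 => x _; exact: T0.
rewrite /T.
under eq_integral do rewrite EFinM.
rewrite ge0_integralZl//; last 2 first.
- by apply/measurable_EFinP; apply: measurable_indic; exact: measurable_gt_fun.
- by rewrite lee_fin ltW.
rewrite integral_indic//; last exact: measurable_gt_fun.
rewrite setIT; apply: (@le_trans _ _
  ((2 ^+ j.+1 * L)%:E * (K * (2 ^+ j * L) `^ (- p))%:E)%E).
  by apply: lee_wpmul2l; [rewrite lee_fin ltW|exact: wF].
rewrite -EFinM lee_fin le_eqVlt; apply/orP; left; apply/eqP.
rewrite (powR_negE p (L20 j)).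
rewrite powRM ?exprn_ge0//; last exact: ltW.
have -> : (2 ^+ j) `^ (1 - p) = z ^+ j.
  by rewrite -powR_mulrn// -powRrM mulrC powRrM powR_mulrn.
have h : (2 ^+ j : R) != 0 by rewrite expf_neq0.
by have := lt0r_neq0 L0 => L0'; rewrite exprS; field; rewrite L0' h.
Qed.

End weak_type_theory.

Lemma lebesgue_measure_oo (R : realType) (a b : R) : a <= b ->
  @lebesgue_measure R `]a, b[%classic = (b - a)%:E.
Proof.
rewrite le_eqVlt => /predU1P[->|ab].
  by rewrite set_itvoo0 measure0 subrr.
by rewrite lebesgue_measure_itv/= lte_fin ab EFinD.
Qed.

Lemma lebesgue_measure_oc (R : realType) (a b : R) : a <= b ->
  @lebesgue_measure R `]a, b]%classic = (b - a)%:E.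
Proof.
rewrite le_eqVlt => /predU1P[->|ab].
  by rewrite set_itvoc0 measure0 subrr.
by rewrite lebesgue_measure_itv/= lte_fin ab EFinD.
Qed.

(** The superlevel set at [lam] is contained in an interval of length 2 lam^(-1/c) around [tau], so
    the power is of weak type 1/c > 1 with constant 2, whatever [tau]. Truncation at level 1 then
    replaces the computation of an improper integral. *)
Lemma singular_integral_bound (R : realType) (c T : R) : 0 < c -> c < 1 -> 0 < T ->
  exists2 C, 0 <= C & forall tau,
    (\int[@lebesgue_measure R]_(t in `]0%R, T[) (`|t - tau| `^ (- c))%:E
       <= C%:E)%E.
Proof.
move=> c0 c1 T0.
have K20 : (0 : R) <= 2 by [].
have ic1 : 1 < c^-1 by rewrite invf_gt1.
exists (T + weak_const c^-1 * 2 * 1 `^ (1 - c^-1)).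
  apply: addr_ge0; first exact: ltW.
  by apply: mulr_ge0; [apply: mulr_ge0 => //; exact: weak_const_ge0|exact: powR_ge0].
move=> tau.
pose F t : R := `|t - tau| `^ (- c).
pose k t : R := \1_`]0, T[ t.
have mF : measurable_fun [set: R] F.
  apply: (measurableT_comp (measurable_powR _)) => //.
  by apply: (measurableT_comp (@normr_measurable _ _)) => //; exact: measurable_funB.
have wF : weak_type (@lebesgue_measure R) c^-1 2 F.
  move=> lam lam0.
  pose r := lam `^ (- c^-1).
  have r0 : 0 < r by exact: powR_gt0.
  apply: (@le_trans _ _ (lebesgue_measure (`](tau - r), (tau + r)[%classic : set R))).
    apply: le_measure; rewrite ?inE//; first exact: measurable_gt_fun.
    move=> t /=; rewrite /F in_itv/= => lamF.
    rewrite -ltr_distl.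
    have [tt0|tt0] := eqVneq `|t - tau| 0; first by rewrite tt0.
    have tgt0 : 0 < `|t - tau| by rewrite lt_def tt0/=.
    exact: ltr_powR_neg_inv.
  have rr : tau - r <= tau + r by clear -r0; lra.
  rewrite [leLHS](lebesgue_measure_oo rr) lee_fin.
  by rewrite -/r opprB addrC addrA subrK mulr_natl mulr2n.
have := @weak_type_integral _ _ _ (@lebesgue_measure R) F k c^-1 2 1.
move=> /(_ _ K20 ltr01 mF) H.
rewrite integral_mkcond (_ : _ \_ _ = fun x => (F x * k x)%:E); last first.
  apply/funext => x; rewrite patchE /F /k indicE.
  by case: ifPn; rewrite ?mulr1 ?mulr0.
apply: (le_trans (H _ _ _ _ wF)).
- by rewrite invf_gt1.
- by move=> x; exact: powR_ge0.
- exact: measurable_indic.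
- by move=> x; rewrite /k indicE; case: (_ \in _); rewrite ?ler01 ?lexx.
- rewrite mul1e integral_indic// setIT.
  by rewrite [X in (X + _)%E](lebesgue_measure_oo (ltW T0)) subr0 EFinD.
Qed.

(** * Lorentz norms and layer cakes *)

(** Preimages of upper rays are intervals. *)
Lemma nonincreasing_emeasurable (R : realType) (f : R -> \bar R) :
  (forall s t, s <= t -> (f t <= f s)%E) -> measurable_fun [set: R] f.
Proof.
move=> f_ni _; apply: (measurability _ (ErealGenOInfty.measurableE R)) => //.
move=> /= _ [_ [x ->] <-]; apply: measurableI => //.
apply: is_interval_measurable => s t /=.
rewrite !in_itv/= !andbT => fs ft u /andP[su ut].
by rewrite in_itv/= andbT (lt_le_trans ft)// f_ni.
Qed.

Lemma powRK (R : realType) (r x : R) : 0 < r -> 0 <= x -> (x `^ r) `^ r^-1 = x.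
Proof. by move=> r0 x0; rewrite -powRrM mulfV ?gt_eqF// powRr1. Qed.

Section lorentz_theory.
Context d (X : measurableType d) (R : realType).
Variable mu : {measure set X -> \bar R}.
Implicit Types (f : X -> R[i]) (q r : R).

Lemma measurable_normc D f : measurable D -> cmeasurable D f ->
  measurable_fun D (@normc R \o f).
Proof.
move=> mD [mRe mIm].
have -> : @normc R \o f =
    fun x => Num.sqrt (complex.Re (f x) ^+ 2 + complex.Im (f x) ^+ 2).
  by apply/funext => x /=; case: (f x).
have msqrt : measurable_fun [set: R] (@Num.sqrt R).
  apply: continuous_measurable_fun; exact: sqrt_continuous.
by apply: (measurableT_comp msqrt); apply: measurable_funD; apply: measurable_funX.
Qed.

Lemma cmeasurable_distrib f lam : cmeasurable setT f ->
  measurable [set x | lam < normc (f x)].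
Proof.
move=> mf; exact: (@measurable_gt_fun _ _ _ (@normc R \o f) lam (measurable_normc measurableT mf)).
Qed.

Lemma le_distrib_fun f (l l' : R) : cmeasurable setT f -> l <= l' ->
  (distrib_fun mu f l' <= distrib_fun mu f l)%E.
Proof.
move=> mf ll'; apply: le_measure; rewrite ?inE; try exact: cmeasurable_distrib.
by move=> x /=; exact: le_lt_trans.
Qed.

Lemma rearrangement_ge0 f t : (0 <= rearrangement mu f t)%E.
Proof. by apply: le_ereal_inf_tmp => _ [l [l0 _] <-]; rewrite lee_fin ltW. Qed.

Lemma le_rearrangement f t t' : t <= t' ->
  (rearrangement mu f t' <= rearrangement mu f t)%E.
Proof.
move=> tt'; apply: ereal_inf_le_tmp => _ [l [l0 lt] <-] /=; exists l => //.
by split => //; rewrite (le_trans lt)// lee_fin.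
Qed.

(** An admissible level l' < l would give d_f(l) <= d_f(l') <= t. This half of the duality between
    the distribution function and the rearrangement requires no one-sided continuity. *)
Lemma rearrangement_ge f (l t : R) : cmeasurable setT f ->
  (t%:E < distrib_fun mu f l)%E -> (l%:E <= rearrangement mu f t)%E.
Proof.
move=> mf tl; apply: le_ereal_inf_tmp => _ [l' [l'0 l't] <-].
rewrite lee_fin leNgt; apply/negP => l'l.
have := lt_le_trans tl (le_trans (le_distrib_fun mf (ltW l'l)) l't).
by rewrite ltxx.
Qed.

Lemma fine_inve q : 0 < q -> fine (q%:E^-1)%E = q^-1.
Proof. by move=> q0; rewrite inver gt_eqF. Qed.

Lemma measurable_rearrangement f :
  measurable_fun [set: R] (rearrangement mu f).
Proof. by apply: nonincreasing_emeasurable => s t; exact: le_rearrangement. Qed.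

Lemma measurable_distrib_fun f : cmeasurable setT f ->
  measurable_fun [set: R] (distrib_fun mu f).
Proof.
by move=> mf; apply: nonincreasing_emeasurable => s t; exact: le_distrib_fun.
Qed.

Definition lorentz_integrand q r f (t : R) : \bar R :=
  (((t `^ q^-1)%:E * rearrangement mu f t) `^ r * (t^-1)%:E)%E.

Lemma lorentz_integrand_ge0 q r f t : 0 < t -> (0 <= lorentz_integrand q r f t)%E.
Proof.
by move=> t0; rewrite mule_ge0 ?poweR_ge0// lee_fin invr_ge0 ltW.
Qed.

Lemma measurable_lorentz_integrand q r f :
  measurable_fun (`]0, +oo[%classic : set R) (lorentz_integrand q r f).
Proof.
apply: (@eq_measurable_fun _ _ _ _ _ (fun t =>
  ((t `^ q^-1)%:E * rearrangement mu f t) `^ r * (t `^ (-1))%:E)%E).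
  move=> x; rewrite inE/= in_itv/= andbT => x0.
  by rewrite powR_inv1// ltW.
apply: measurable_funTS; apply: emeasurable_funM; last first.
  by apply/measurable_EFinP; exact: measurable_powR.
apply: (measurableT_comp (measurable_poweR r)).
apply: emeasurable_funM; last exact: measurable_rearrangement.
by apply/measurable_EFinP; exact: measurable_powR.
Qed.

Lemma lorentz_integral_le q r M f : 0 < q -> 0 < r ->
  (lorentz_norm mu q%:E r%:E f <= M%:E)%E ->
  (\int[@lebesgue_measure R]_(t in `]0%R, +oo[) lorentz_integrand q r f t
     <= (M `^ r)%:E)%E.
Proof.
move=> q0 r0; rewrite /lorentz_norm fine_inve//.
rewrite -/(lorentz_integrand q r f).
set I := (\int[_]_(t in _) _)%E => IM.
have I0 : (0 <= I)%E.
  apply: integral_ge0 => t /=; rewrite in_itv/= andbT => t0.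
  exact: lorentz_integrand_ge0.
have -> : I = (I `^ r^-1 `^ r)%E by rewrite -poweRrM mulVf ?gt_eqF// poweRe1.
rewrite -poweR_EFin gt0_ler_poweR// ?ltW// in_itv/= leey ?poweR_ge0//.
by rewrite (le_trans _ IM)// poweR_ge0.
Qed.

(** On ]t/2, t[ the rearrangement is at least its value at t and 1/u is at least 1/t, so this
    interval alone contributes ((t/2)^(1/q) f^*(t))^r / 2 to the Lorentz integral. Hence the factors
    2^(1/r) and (t/2)^(-1/q). *)
Lemma rearrangement_le_lorentz q r M f t : 0 < q -> 0 < r -> 0 <= M ->
  (lorentz_norm mu q%:E r%:E f <= M%:E)%E -> 0 < t ->
  (rearrangement mu f t <= (2 `^ r^-1 * M * (t / 2) `^ (- q^-1))%:E)%E.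
Proof.
move=> q0 r0 M0 fM t0.
pose h := t / 2; have h0 : 0 < h by rewrite divr_gt0.
pose c := (((h `^ q^-1)%:E * rearrangement mu f t) `^ r)%E.
have c0 : (0 <= c)%E by exact: poweR_ge0.
have ht : h <= t by rewrite ler_pdivrMr// ler_peMr ?ler1n// ltW.
have cM : (c * (2^-1)%:E <= (M `^ r)%:E)%E.
  apply: le_trans (lorentz_integral_le q0 r0 fM).
  apply: (@le_trans _ _ (\int[@lebesgue_measure R]_(u in `]h, t[)
      lorentz_integrand q r f u)%E); last first.
    apply: ge0_subset_integral => //.
    - exact: measurable_lorentz_integrand.
    - move=> u /=; rewrite in_itv/= andbT; exact: lorentz_integrand_ge0.
    - move=> u /=; rewrite !in_itv/= andbT => /andP[hu _]; exact: lt_trans hu.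
  apply: (@le_trans _ _ (\int[@lebesgue_measure R]_(u in `]h, t[)
      (c * (t^-1)%:E))%E).
    rewrite integral_cst// [X in (_ <= _ * X)%E](lebesgue_measure_oo ht) -muleA.
    rewrite -EFinM (_ : _ * _ = 2^-1)//; have := lt0r_neq0 t0; rewrite /h => t0'.
    by field.
  apply: ge0_le_integral => //.
  - by move=> u _; rewrite mule_ge0// lee_fin invr_ge0 ltW.
  - apply: (measurable_funS _ _ (@measurable_lorentz_integrand q r f)) => //.
    move=> u /=; rewrite !in_itv/= andbT => /andP[hu _]; exact: lt_trans hu.
  - move=> u /=; rewrite in_itv/= => /andP[hu ut].
    have u0 := lt_trans h0 hu.
    apply: lee_pmul => //.
      by rewrite lee_fin invr_ge0 ltW.
      rewrite /c; apply: gt0_ler_poweR; first exact: ltW.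
      - by rewrite in_itv/= leey mule_ge0// ?lee_fin ?powR_ge0// rearrangement_ge0.
      - by rewrite in_itv/= leey mule_ge0// ?lee_fin ?powR_ge0// rearrangement_ge0.
      - apply: lee_pmul => //; rewrite ?rearrangement_ge0 ?lee_fin ?powR_ge0//.
          by apply: ge0_ler_powR; rewrite ?nnegrE ?invr_ge0 ?ltW.
        by apply: le_rearrangement; exact: ltW.
    by rewrite lee_fin lef_pV2 ?posrE ?ltW.
have hq0 : 0 < h `^ q^-1 by rewrite powR_gt0.
move: cM; rewrite /c; move: (rearrangement_ge0 f t).
case: (rearrangement mu f t) => [b| |]//.
- rewrite lee_fin => b0; rewrite -EFinM lee_fin.
  rewrite ler_pdivrMr// (mulrC _ 2) => bM.
  have : ((h `^ q^-1 * b) `^ r) `^ r^-1 <= (2 * M `^ r) `^ r^-1.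
    by apply: ge0_ler_powR => //; rewrite ?nnegrE ?invr_ge0 ?(ltW r0) ?mulr_ge0 ?powR_ge0.
  rewrite powRK ?mulr_ge0 ?powR_ge0// powRM ?powR_ge0// powRK//.
  move=> bM'; rewrite lee_fin powRN ler_pdivlMr//.
  by rewrite mulrC.
- by move=> _; rewrite gt0_muley ?lte_fin// poweRyr ?gt_eqF// gt0_mulye ?lte_fin// leye_eq.
Qed.


(** The inclusion of L^(q,r) in weak L^q. The constant is chosen before f, here and in the lemmas
    that follow, because it will be applied to u(t) for almost every t and must not depend on t. *)
Lemma rearrangement_bound q (r : \bar R) M : 0 < q -> (0 < r)%E -> 0 <= M ->
  exists2 C, 0 <= C & forall f, (lorentz_norm mu q%:E r f <= M%:E)%E ->
    forall t, 0 < t -> (rearrangement mu f t <= (C * t `^ (- q^-1))%:E)%E.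
Proof.
move=> q0; case: r => [r| |]//; rewrite ?lte_fin => r0 M0.
  exists (2 `^ r^-1 * M * (2^-1) `^ (- q^-1)).
    by rewrite !mulr_ge0 ?powR_ge0.
  move=> f fM t t0; apply: le_trans (rearrangement_le_lorentz q0 r0 M0 fM t0) _.
  by rewrite lee_fin powRM ?invr_ge0// ?(ltW t0)// [t `^ _ * _]mulrC mulrA.
exists M => // f; rewrite /lorentz_norm fine_inve// => fM t t0.
have := le_trans (ereal_sup_ubound _) fM.
move=> /(_ _ (ex_intro2 _ _ t _ erefl)); rewrite /= in_itv/= andbT => /(_ t0).
rewrite powRN; have := powR_gt0 q^-1 t0.
move: (rearrangement_ge0 f t); case: (rearrangement mu f t) => [b| |]//.
- by rewrite !lee_fin => b0 tq0; rewrite ler_pdivlMr// mulrC.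
- by move=> _ tq0; rewrite gt0_muley ?lte_fin// leye_eq.
Qed.

Lemma lorentz_weak_type q (r : \bar R) M : 0 < q -> (0 < r)%E -> 0 <= M ->
  exists2 K, 0 <= K & forall f, cmeasurable setT f ->
    (lorentz_norm mu q%:E r f <= M%:E)%E -> weak_type mu q K (@normc R \o f).
Proof.
move=> q0 r0 M0; have [C C0 HC] := rearrangement_bound q0 r0 M0.
exists (C `^ q) => [|f mf fM l l0]; first exact: powR_ge0.
rewrite -/(distrib_fun mu f l) leNgt; apply/negP => lt.
set A := C `^ q * l `^ (- q) in lt.
have A0 : 0 <= A by rewrite mulr_ge0// powR_ge0.
(* The distribution function may be infinite at [l], whereas the rearrangement takes a real
   argument; hence a real [D] strictly in between. *)
have [D AD Dlt] : exists2 D, A < D & (D%:E < distrib_fun mu f l)%E.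
  move: lt; case: (distrib_fun mu f l) => [b| |]//.
    rewrite lte_fin => Ab; exists ((A + b) / 2); last rewrite lte_fin.
      by rewrite midf_lt.
    by rewrite midf_lt.
  by move=> _; exists (A + 1); rewrite ?ltrDl// ltry.
have D0 := le_lt_trans A0 AD.
have := le_trans (rearrangement_ge mf Dlt) (HC f fM D D0).
rewrite lee_fin powRN ler_pdivlMr ?powR_gt0// mulrC -ler_pdivlMr// => DC.
move: AD; rewrite ltNge => /negP; apply.
have := @ge0_ler_powR _ q (ltW q0) _ _ _ _ DC.
rewrite !nnegrE powR_ge0 divr_ge0 ?(ltW l0)// => /(_ isT isT).
rewrite -powRrM mulVf ?gt_eqF// powRr1 ?(ltW D0)// => /le_trans; apply.
by rewrite powRM ?invr_ge0 ?(ltW l0)// -powR_inv1 ?(ltW l0)// -powRrM mulN1r.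
Qed.

(** With y = t^(1/q) f^*(t) one writes y^a = y^(a-r) y^r: the first factor is bounded by the
    weak-type estimate, the second is the given Lorentz integrand. The integral is expressed through
    real values in the form that the layer cake argument produces. *)
Lemma lorentz_embedding q r a M : 0 < q -> 0 < r -> r < a -> 0 <= M ->
  exists2 C, 0 <= C & forall f,
    (lorentz_norm mu q%:E r%:E f <= M%:E)%E ->
    (\int[@lebesgue_measure R]_(t in `]0%R, +oo[)
       (t `^ (a / q - 1) * fine (rearrangement mu f t) `^ a)%:E <= C%:E)%E.
Proof.
move=> q0 r0 ra M0.
have [C C0 HC] := @rearrangement_bound q r%:E M q0 r0 M0.
exists (C `^ (a - r) * M `^ r) => [|f fM]; first by rewrite mulr_ge0 ?powR_ge0.
have fin t : 0 < t -> rearrangement mu f t = (fine (rearrangement mu f t))%:E.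
  move=> t0; rewrite fineK// ge0_fin_numE ?rearrangement_ge0//.
  by rewrite (le_lt_trans (HC f fM t t0))// ltry.
apply: (@le_trans _ _ (\int[@lebesgue_measure R]_(t in `]0%R, +oo[)
    ((C `^ (a - r))%:E * lorentz_integrand q r f t))%E); last first.
  rewrite ge0_integralZl ?lee_fin ?powR_ge0//; last 2 first.
  - exact: measurable_lorentz_integrand.
  - move=> t /=; rewrite in_itv/= andbT; exact: lorentz_integrand_ge0.
  by rewrite EFinM lee_wpmul2l ?lee_fin ?powR_ge0//; exact: lorentz_integral_le.
apply: ge0_le_integral => //.
- by move=> t _; rewrite lee_fin mulr_ge0 ?powR_ge0.
- apply/measurable_EFinP; apply: measurable_funTS; apply: measurable_funM.
    exact: measurable_powR.
  apply: (measurableT_comp (measurable_powR a)).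
  apply: (measurableT_comp (fine_measurable measurableT)) => //.
  exact: measurable_rearrangement.
- by apply: measurable_funeM; exact: measurable_lorentz_integrand.
move=> t /=; rewrite in_itv/= andbT => t0.
have := HC f fM t t0; rewrite /lorentz_integrand fin//=.
have := rearrangement_ge0 f t; rewrite (fin t)//=.
move: (fine _) => b; rewrite !lee_fin => b0 bC.
rewrite ?lee_fin.
set y := t `^ q^-1 * b.
have y0 : 0 <= y by rewrite mulr_ge0 ?powR_ge0.
have yC : y <= C.
  by rewrite /y mulrC -ler_pdivlMr ?powR_gt0// -powRN.
have -> : t `^ (a / q - 1) * b `^ a = y `^ a * t^-1.
  rewrite /y powRM ?powR_ge0// -powRrM (mulrC q^-1) powRB ?(gt_eqF t0) ?implybT//.
  by rewrite powRr1 ?ltW//; ring.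
rewrite mulrA ler_wpM2r ?invr_ge0 ?(ltW t0)//.
have -> : y `^ a = y `^ (a - r) * y `^ r.
  by rewrite -powRD ?subrK// (gt_eqF (lt_trans r0 ra)).
rewrite ler_wpM2r ?powR_ge0//.
by rewrite ge0_ler_powR ?nnegrE// subr_ge0 ltW.
Qed.

End lorentz_theory.

Section one_dim.
Context (R : realType).
Local Notation leb := (@lebesgue_measure R).

Lemma integral_ge_itv (h : R -> \bar R) (a b c : R) :
    measurable_fun setT h -> (forall u, (0 <= h u)%E) -> a <= b -> 0 <= c ->
    (forall u, a < u -> u < b -> (c%:E <= h u)%E) ->
  ((c * (b - a))%:E <= \int[leb]_u h u)%E.
Proof.
move=> mh h0 ab c0 ch.
apply: (@le_trans _ _ (\int[leb]_(u in `]a, b[) h u)%E); last first.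
  by apply: ge0_subset_integral.
apply: (@le_trans _ _ (\int[leb]_(u in `]a, b[) c%:E)%E).
  by rewrite integral_cst// [X in (_ <= _ * X)%E](lebesgue_measure_oo ab).
apply: ge0_le_integral => //; first exact: measurable_funTS.
by move=> u /=; rewrite in_itv/= => /andP[]; exact: ch.
Qed.

Lemma integral_le_itv (h : R -> \bar R) (a b c : R) :
    measurable_fun setT h -> (forall u, (0 <= h u)%E) -> a <= b -> 0 <= c ->
    (forall u, (h u <= (c * \1_(`]a, b]%classic : set R) u)%:E)%E) ->
  (\int[leb]_u h u <= (c * (b - a))%:E)%E.
Proof.
move=> mh h0 ab c0 hc.
apply: (@le_trans _ _ (\int[leb]_u (c%:E * (\1_(`]a, b]%classic : set R) u)%:E))%E).
  apply: ge0_le_integral => //.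
  by apply: measurable_funeM; apply/measurable_EFinP; exact: measurable_indic.
rewrite ge0_integralZl//; last first.
  by apply/measurable_EFinP; exact: measurable_indic.
rewrite integral_indic// setIT EFinM lee_wpmul2l//.
by rewrite [leLHS](lebesgue_measure_oc ab).
Qed.

End one_dim.

(** * Weighted integrals controlled by the rearrangement *)

Section layer_cake.
Context d (X : measurableType d) (R : realType).
Variable mu : {sigma_finite_measure set X -> \bar R}.
Local Notation leb := (@lebesgue_measure R).

(** A double layer cake. First |f|^a is replaced by an integral of l^(a-1) over 0 < l < |f|, so that
    W is integrated over superlevel sets and gives A d_f(l)^e; then d_f(l)^e is replaced by an
    integral of t^(e-1) over 0 < t < d_f(l). After exchanging l and t, the integral in l is at most
    f^*(t)^a. Both replacements only use the upper half of the interval of integration, which costs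
    2^a and 2 but needs no antiderivative. *)
Lemma layer_cake_lorentz (W : X -> R) (f : X -> R[i]) (A e a : R) :
    0 <= A -> 0 < e -> e <= 1 -> 1 <= a ->
    measurable_fun setT W -> (forall x, 0 <= W x) -> cmeasurable setT f ->
    (forall l, 0 < l -> (distrib_fun mu f l < +oo)%E) ->
    (forall t, 0 < t -> (rearrangement mu f t < +oo)%E) ->
    (forall E m, measurable E -> mu E = m%:E ->
       (\int[mu]_x (W x * \1_E x)%:E <= (A * m `^ e)%:E)%E) ->
  (\int[mu]_x (W x * normc (f x) `^ a)%:E <= (2 `^ a * (A * 2))%:E *
   \int[leb]_(t in `]0%R, +oo[) (t `^ (e - 1) * fine (rearrangement mu f t) `^ a)%:E)%E.
Proof.
move=> A0 e0 e1 a1 mW W0 mf dfin rfin WE.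
have a10 : 0 <= a - 1 by rewrite subr_ge0.
pose g := @normc R \o f.
have g0 x : 0 <= g x by rewrite /g/=; case: (f x) => ? ?; exact: sqrtr_ge0.
have mg : measurable_fun setT g by exact: measurable_normc.
pose D := fine \o distrib_fun mu f.
have mD : measurable_fun [set: R] D.
  apply: (measurableT_comp (fine_measurable measurableT)).
  exact: measurable_distrib_fun.
pose phi := fine \o rearrangement mu f.
have mphi : measurable_fun [set: R] phi.
  apply: (measurableT_comp (fine_measurable measurableT)).
  exact: measurable_rearrangement.
have DE l : 0 < l -> distrib_fun mu f l = (D l)%:E.
  by move=> l0; rewrite /D/= fineK// ge0_fin_numE ?dfin// measure_ge0.
have phiE t : 0 < t -> rearrangement mu f t = (phi t)%:E.
  by move=> t0; rewrite /phi/= fineK// ge0_fin_numE ?rfin// rearrangement_ge0.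
pose S1 : set (X * R) := [set z | 0 < z.2 /\ z.2 < g z.1].
have mS1 : measurable S1.
  rewrite (_ : S1 = [set z | 0 < z.2] `&` [set z | 0 < g z.1 - z.2]).
    apply: measurableI.
      exact: (@measurable_gt_fun _ _ _ (@snd X R) 0 measurable_snd).
    apply: (@measurable_gt_fun _ _ _ (fun z : X * R => g z.1 - z.2)).
    by apply: measurable_funB => //; exact: measurableT_comp.
  by apply/seteqP; split => z /=; rewrite /S1/= subr_gt0.
pose k (z : X * R) : \bar R := (W z.1 * z.2 `^ (a - 1) * \1_S1 z)%:E.
have k0 z : (0 <= k z)%E by rewrite lee_fin !mulr_ge0// powR_ge0.
have mk : measurable_fun setT k.
  apply/measurable_EFinP; apply: measurable_funM; last exact: measurable_indic.
  apply: measurable_funM; first exact: measurableT_comp.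
  by apply: (measurableT_comp (measurable_powR (a - 1))).
have step1 x : ((W x * g x `^ a)%:E <= (2 `^ a)%:E * \int[leb]_l k (x, l))%E.
  have [gx0|gxn0] := eqVneq (g x) 0.
    rewrite gx0 powR0 ?mulr0; last by rewrite gt_eqF// (lt_le_trans ltr01 a1).
    by rewrite mule_ge0 ?lee_fin ?powR_ge0// integral_ge0.
  have gx0 : 0 < g x by rewrite lt_def gxn0/=.
  have h2 : 0 < g x / 2 by rewrite divr_gt0.
  have := @integral_ge_itv R (fun l => k (x, l)) (g x / 2) (g x)
    (W x * (g x / 2) `^ (a - 1)).
  move=> H; have {}H : ((W x * (g x / 2) `^ a)%:E <= \int[leb]_l k (x, l))%E.
    rewrite -mulr_powRB1 ?(ltW h2)//; last by rewrite (lt_le_trans ltr01 a1).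
    apply: le_trans (H _ _ _ _ _); first last.
    - move=> u u1 u2; rewrite /k indicE mem_set/=; last first.
        by split => //; exact: lt_trans u1.
      rewrite mulr1 lee_fin ler_wpM2l// ge0_ler_powR ?nnegrE ?(ltW u1)//.
        exact: ltW.
      by rewrite ltW// (lt_trans h2).
    - by rewrite mulr_ge0 ?powR_ge0.
    - by rewrite ler_pdivrMr// ler_peMr ?ler1n// ltW.
    - by [].
    - exact: measurable_fun_pair2.
    by rewrite lee_fin le_eqVlt; apply/orP; left; apply/eqP; by field.
  apply: le_trans (lee_wpmul2l _ H); last by rewrite lee_fin powR_ge0.
  rewrite -EFinM lee_fin mulrCA -powRM ?(ltW h2)//.
  by rewrite (_ : 2 * (g x / 2) = g x)//; field.
apply: (@le_trans _ _ ((2 `^ a)%:E * \int[leb]_l \int[mu]_x k (x, l))%E).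
  have <- : (\int[mu]_x \int[leb]_l k (x, l) = \int[leb]_l \int[mu]_x k (x, l))%E.
    exact: (fubini_tonelli (m1 := mu) (m2 := leb) k mk k0).
  have mF : measurable_fun setT (fun x => \int[leb]_l k (x, l))%E.
    exact: (measurable_fun_fubini_tonelli_F (m2 := leb) k mk k0).
  rewrite -ge0_integralZl ?lee_fin ?powR_ge0//; last first.
    by move=> x _; apply: integral_ge0.
  apply: ge0_le_integral => //.
  - by move=> x _; rewrite lee_fin mulr_ge0 ?powR_ge0.
  - apply/measurable_EFinP; apply: measurable_funM => //.
    exact: (measurableT_comp (measurable_powR a)).
  - exact: measurable_funeM.
rewrite EFinM -muleA lee_wpmul2l ?lee_fin ?powR_ge0//.
(* The region under the distribution function. For fixed t its section in l is contained in 0 < l <=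
   f^*(t), which is where the rearrangement enters. *)
pose S2 : set (R * R) := [set z | [/\ 0 < z.1, 0 < z.2 & z.2 < D z.1]].
have mS2 : measurable S2.
  rewrite (_ : S2 = [set z | 0 < z.1] `&` ([set z | 0 < z.2] `&` [set z | 0 < D z.1 - z.2])).
    apply: measurableI.
      exact: (@measurable_gt_fun _ _ _ (@fst R R) 0 measurable_fst).
    apply: measurableI.
      exact: (@measurable_gt_fun _ _ _ (@snd R R) 0 measurable_snd).
    apply: (@measurable_gt_fun _ _ _ (fun z : R * R => D z.1 - z.2)).
    by apply: measurable_funB => //; exact: measurableT_comp.
  apply/seteqP; split => z /=; rewrite /S2/= subr_gt0.
    by move=> [].
  by move=> [? []].
pose j (z : R * R) : \bar R := (z.1 `^ (a - 1) * z.2 `^ (e - 1) * \1_S2 z)%:E.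
have j0 z : (0 <= j z)%E by rewrite lee_fin !mulr_ge0// powR_ge0.
have mj : measurable_fun setT j.
  apply/measurable_EFinP; apply: measurable_funM; last exact: measurable_indic.
  apply: measurable_funM.
    exact: (measurableT_comp (measurable_powR (a - 1))).
  exact: (measurableT_comp (measurable_powR (e - 1))).
have step3 l : (\int[mu]_x k (x, l) <= (A * 2)%:E * \int[leb]_t j (l, t))%E.
  have [l0|l0] := leP l 0.
    rewrite (eq_integral (fun=> 0%E)); last first.
      move=> x _; rewrite /k indicE memNset ?mulr0//= /S1/=.
      by move=> [l0']; move: (lt_le_trans l0' l0); rewrite ltxx.
    by rewrite integral0 mule_ge0 ?lee_fin ?mulr_ge0// integral_ge0.
  pose E := [set x | l < g x].
  have mE : measurable E by exact: measurable_gt_fun.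
  rewrite (eq_integral (fun x => (l `^ (a - 1))%:E * (W x * \1_E x)%:E)%E); last first.
    move=> x _; rewrite /k -EFinM mulrA (mulrC (l `^ _)); congr (_ * _)%:E.
    rewrite !indicE; congr (nat_of_bool _)%:R.
    apply/idP/idP; rewrite !inE /S1 /E /=; last by split.
    by move=> [].
  rewrite ge0_integralZl ?lee_fin ?powR_ge0//; last 2 first.
  - by apply/measurable_EFinP; apply: measurable_funM => //; exact: measurable_indic.
  - by move=> x _; rewrite lee_fin mulr_ge0.
  have Dl0 : 0 <= D l by rewrite /D fine_ge0// measure_ge0.
  apply: (@le_trans _ _ ((l `^ (a - 1))%:E * (A * D l `^ e)%:E)%E).
    by rewrite lee_wpmul2l ?lee_fin ?powR_ge0//; apply: WE => //; exact: DE.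
  have [Dle|Dgt] := leP (D l) 0.
    rewrite (_ : D l = 0) ?powR0 ?gt_eqF//; last by apply/eqP; rewrite eq_le Dle.
    by rewrite mulr0 mule0 mule_ge0 ?lee_fin ?mulr_ge0// integral_ge0.
  have := @integral_ge_itv R (fun t => j (l, t)) (D l / 2) (D l)
    (l `^ (a - 1) * D l `^ (e - 1)).
  move=> H; have {}H : ((l `^ (a - 1) * D l `^ e / 2)%:E <= \int[leb]_t j (l, t))%E.
    apply: le_trans (H _ _ _ _ _); first last.
    - move=> u u1 u2; have u0 : 0 < u by rewrite (le_lt_trans _ u1)// divr_ge0.
      rewrite /j indicE mem_set/=; last by split.
      rewrite mulr1 lee_fin ler_wpM2l ?powR_ge0//.
      have [->|en1] := eqVneq e 1; first by rewrite subrr !powRr0.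
      have e1' : 0 < 1 - e by rewrite subr_gt0 lt_def eq_sym en1.
      by rewrite -opprB ltW// ltr_powR_neg.
    - by rewrite mulr_ge0 ?powR_ge0.
    - by rewrite ler_pdivrMr// ler_peMr ?ler1n.
    - by [].
    - by apply: measurable_fun_pair2.
    rewrite lee_fin -[D l `^ e]mulr_powRB1// le_eqVlt; apply/orP; left; apply/eqP.
    by field.
  apply: le_trans (lee_wpmul2l _ H); last by rewrite lee_fin mulr_ge0.
  rewrite -!EFinM lee_fin le_eqVlt; apply/orP; left; apply/eqP; by field.
apply: (@le_trans _ _ ((A * 2)%:E * \int[leb]_t \int[leb]_l j (l, t))%E).
  have <- : (\int[leb]_l \int[leb]_t j (l, t) = \int[leb]_t \int[leb]_l j (l, t))%E.
    exact: (fubini_tonelli (m1 := leb) (m2 := leb) j mj j0).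
  have mF : measurable_fun setT (fun l => \int[leb]_t j (l, t))%E.
    exact: (measurable_fun_fubini_tonelli_F (m2 := leb) j mj j0).
  rewrite -ge0_integralZl ?lee_fin ?mulr_ge0//; last first.
    by move=> x _; apply: integral_ge0.
  apply: ge0_le_integral => //.
  - by move=> x _; apply: integral_ge0.
  - exact: (measurable_fun_fubini_tonelli_G (m1 := mu) k mk k0).
  - exact: measurable_funeM.
rewrite lee_wpmul2l ?lee_fin ?mulr_ge0//.
rewrite [leRHS]integral_mkcond.
apply: ge0_le_integral => //.
- by move=> x _; apply: integral_ge0.
- exact: (measurable_fun_fubini_tonelli_G (m1 := leb) j mj j0).
- apply/(measurable_restrictT _ _).1 => //; apply: measurable_funTS.
  apply/measurable_EFinP; apply: measurable_funM; first exact: measurable_powR.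
  exact: (measurableT_comp (measurable_powR a)).
move=> t _; rewrite patchE; case: ifPn => [|tn]; last first.
  rewrite (eq_integral (fun=> 0%E)) ?integral0// => l _.
  rewrite /j indicE memNset ?mulr0//= => -[_ t0 _]; move/negP: tn; apply.
  by rewrite inE/= in_itv/= t0.
rewrite inE/= in_itv/= andbT => t0.
have p0 : 0 <= phi t by rewrite /phi/= fine_ge0// rearrangement_ge0.
have -> : t `^ (e - 1) * phi t `^ a = (t `^ (e - 1) * phi t `^ (a - 1)) * (phi t - 0).
  rewrite subr0 -mulrA (mulrC (phi t `^ (a - 1))) mulr_powRB1//.
  by rewrite (lt_le_trans ltr01 a1).
apply: integral_le_itv => //.
- by apply: measurable_fun_pair1.
- by rewrite mulr_ge0 ?powR_ge0.
move=> l; rewrite /j lee_fin indicE; case: (boolP ((l, t) \in S2)); last first.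
  by rewrite mulr0 !mulr_ge0 ?powR_ge0.
rewrite inE => -[/= l0 _ tD]; rewrite mulr1.
have lphi : l <= phi t.
  rewrite -lee_fin -phiE//; apply: rearrangement_ge => //.
  by rewrite DE// lte_fin.
rewrite indicE mem_set ?mulr1; last by rewrite /= in_itv/= l0.
rewrite mulrC ler_wpM2l ?powR_ge0//.
by rewrite ge0_ler_powR ?nnegrE// ltW.
Qed.

End layer_cake.

(** * Integrals on euclidean space and the heat kernel *)

Section euclid_integrals.
Context (R : realType).
Implicit Types d : nat.

Lemma measurable_coord d (i : 'I_d) :
  measurable_fun [set: euclid R d] (fun x : euclid R d => tnth x i).
Proof. exact: (@measurable_tnth _ (measurableTypeR R) d i). Qed.

(** By construction the measure in dimension d + 1 is the image of a product measure under
    [cons_euclid]; this is the change of variables followed by Tonelli. *)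
Lemma integral_euclidS d (f : euclid R d.+1 -> \bar R) :
    measurable_fun [set: euclid R d.+1] f -> (forall x, (0 <= f x)%E) ->
  (\int[lebesgue_euclid d.+1]_x f x =
   \int[@lebesgue_measure R]_u \int[lebesgue_euclid d]_y f (cons_euclid (u, y)))%E.
Proof.
move=> mf f0.
pose pushm : {measure set (euclid R d.+1) -> \bar R} :=
  measure_function_pushforward__canonical__measure_function_Measure
    (@lebesgue_measure R \x lebesgue_euclid d)%E (@measurable_cons_euclid R d).
transitivity (\int[pushm]_x f x)%E; first by apply: eq_measure_integral => A mA _.
rewrite (ge0_integral_pushforward (@measurable_cons_euclid R d))//.
rewrite preimage_setT fubini_tonelli1//.
  by apply: measurableT_comp => //; exact: measurable_cons_euclid.
by move=> x; exact: f0.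
Qed.

Lemma measurable_prod_coord d (phi : 'I_d -> R -> R) :
  (forall i, measurable_fun setT (phi i)) ->
  measurable_fun [set: euclid R d] (fun x : euclid R d => \prod_(i < d) phi i (tnth x i)).
Proof.
move=> mphi; apply: measurable_prod => i _.
exact: (measurableT_comp (mphi i) (@measurable_coord d i)).
Qed.

Lemma integral_prod_euclid d (phi : 'I_d -> R -> R) :
    (forall i, measurable_fun setT (phi i)) -> (forall i u, 0 <= phi i u) ->
  (\int[lebesgue_euclid d]_x (\prod_(i < d) phi i (tnth x i))%:E =
   \prod_(i < d) \int[@lebesgue_measure R]_u (phi i u)%:E)%E.
Proof.
elim: d phi => [|d IH] phi mphi phi0.
  rewrite big_ord0 (eq_integral (fun=> 1%E)); last first.
    by move=> x _; rewrite big_ord0.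
  by rewrite integral_cst// mul1e /= diracT.
rewrite integral_euclidS; last 2 first.
- by apply/measurable_EFinP; exact: measurable_prod_coord.
- by move=> x; rewrite lee_fin prodr_ge0.
rewrite big_ord_recl -IH//.
pose P (y : euclid R d) : R := \prod_(i < d) phi (lift ord0 i) (tnth y i).
have PE u (y : euclid R d) :
    \prod_(i < d.+1) phi i (tnth (cons_euclid (u, y)) i) = phi ord0 u * P y.
  rewrite big_ord_recl; congr (_ * _).
  by apply: eq_bigr => i _; rewrite tnthS.
have mP : measurable_fun setT (fun y => (P y)%:E).
  by apply/measurable_EFinP; exact: (measurable_prod_coord (phi := fun i => phi (lift ord0 i))).
transitivity (\int[@lebesgue_measure R]_u
    ((phi ord0 u)%:E * \int[lebesgue_euclid d]_y (P y)%:E))%E.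
  apply: eq_integral => u _; rewrite -ge0_integralZl//.
  - by apply: eq_integral => y _; rewrite PE.
  - by move=> y _; rewrite lee_fin prodr_ge0.
  - by rewrite lee_fin.
apply: ge0_integralZr => //.
- by apply/measurable_EFinP; exact: mphi.
- by move=> u _; rewrite lee_fin.
- by apply: integral_ge0 => y _; rewrite lee_fin prodr_ge0.
Qed.

Lemma enorm_sqr d (x : euclid R d) : enorm x ^+ 2 = \sum_(i < d) tnth x i ^+ 2.
Proof. by rewrite sqr_sqrtr// sumr_ge0// => i _; rewrite sqr_ge0. Qed.

Lemma enorm_ge0 d (x : euclid R d) : 0 <= enorm x.
Proof. exact: sqrtr_ge0. Qed.

Lemma measurable_enorm d : measurable_fun [set: euclid R d] (@enorm R d).
Proof.
have msqrt : measurable_fun [set: R] (@Num.sqrt R).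
  by apply: continuous_measurable_fun; exact: sqrt_continuous.
apply: (measurableT_comp msqrt); apply: measurable_sum => i.
by apply: measurable_funX; exact: measurable_coord.
Qed.

Lemma coord_le_enorm d (x : euclid R d) i : `|tnth x i| <= enorm x.
Proof.
rewrite -sqrtr_sqr ler_wsqrtr// (bigD1 i)//= lerDl sumr_ge0// => j _.
exact: sqr_ge0.
Qed.

Lemma measurable_enorm_lt d (r : R) : measurable [set x : euclid R d | enorm x < r].
Proof.
rewrite (_ : mkset _ = [set x | 0 < r - enorm x]).
  apply: (measurable_gt_fun (F := fun x => r - enorm x)).
  by apply: measurable_funB => //; exact: measurable_enorm.
by apply/seteqP; split => x /=; rewrite subr_gt0.
Qed.

(** The ball is contained in a cube of side 2 r. Only the order r^d matters later. *)
Lemma enorm_ball_measure d (r : R) : 0 < r ->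
  (lebesgue_euclid d [set x | (enorm x < r)%R] <= ((2 * r) ^+ d)%:E)%E.
Proof.
move=> r0.
have mB := @measurable_enorm_lt d r.
pose A (i : 'I_d) : set R := `]- r, r[%classic.
have mA i : measurable (A i : set (measurableTypeR R)) by exact: measurable_itv.
have mBox : measurable [set x : euclid R d | forall i, A i (tnth x i)].
  rewrite (_ : mkset _ = \bigcap_i [set x : euclid R d | A i (tnth x i)]).
    apply: fin_bigcap_measurable => // i _; rewrite -[X in measurable X]setTI.
    by apply: measurable_coord => //; exact: mA.
  by apply/seteqP; split=> [x h i _|x h i]; exact: h.
apply: (@le_trans _ _ (lebesgue_euclid d [set x | forall i, A i (tnth x i)])).
  apply: le_measure; rewrite ?inE// => x /= xr i; rewrite /A/= in_itv/=.
  by rewrite -ltr_norml (le_lt_trans (coord_le_enorm x i)).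
rewrite lebesgue_euclid_box//.
have rr : - r <= r by lra.
rewrite (eq_bigr (fun=> (2 * r)%:E)); last first.
  by move=> i _; rewrite [LHS](lebesgue_measure_oo rr); congr EFin; ring.
by rewrite prodEFin lee_fin prodr_const card_ord.
Qed.

Lemma enorm_neq0_ae d : (0 < d)%N -> \forall x \ae lebesgue_euclid d, enorm (R := R) x != 0.
Proof.
move=> d0.
have m0 : measurable [set x : euclid R d | enorm x = 0].
  rewrite -[X in measurable X]setTI.
  exact: (measurable_enorm measurableT (measurable_set1 0)).
exists [set x | enorm x = 0]; split => //; last first.
  by move=> x /= /negP; rewrite negbK => /eqP.
apply/eqP; rewrite eq_le measure_ge0 andbT; apply/lee_addgt0Pr => e e0.
rewrite add0e.
(* With 2 r <= 1 one has (2 r)^d <= 2 r <= e for every positive dimension. *)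
pose r := Num.min 1 e / 2.
have m10 : 0 < Num.min 1 e by rewrite lt_min ltr01 e0.
have r0 : 0 < r by rewrite divr_gt0.
apply: (@le_trans _ _ (lebesgue_euclid d [set x | (enorm x < r)%R])).
  apply: le_measure; rewrite ?inE//; last by move=> x /= ->.
  exact: measurable_enorm_lt.
apply: (le_trans (enorm_ball_measure d r0)); rewrite lee_fin.
have -> : 2 * r = Num.min 1 e by rewrite /r; field.
rewrite -(prednK d0) exprS (@le_trans _ _ (Num.min 1 e))//.
  by rewrite ler_piMr ?(ltW m10)// exprn_ile1 ?(ltW m10)// ge_min lexx.
by rewrite ge_min lexx orbT.
Qed.

Lemma heat_kernel_ge0 d (t : R) (x : euclid R d) : 0 <= heat_kernel t x.
Proof. by rewrite mulr_ge0 ?powR_ge0 ?expR_ge0. Qed.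

(** A name for the tuple written out in [heat_integrand]. *)
Definition vsub d (x y : euclid R d) : euclid R d :=
  [tuple tnth x i - tnth y i | i < d].

Lemma tnth_vsub d (x y : euclid R d) i : tnth (vsub x y) i = tnth x i - tnth y i.
Proof. by rewrite tnth_mktuple. Qed.

(** The heat kernel at time t has variance 2 t in each coordinate, so its total mass reduces to that
    of the one-dimensional normal density. *)
Lemma gaussian_prod d (t : R) (x y : euclid R d) : 0 < t ->
  heat_kernel t (vsub x y) =
  \prod_(i < d) normal_pdf (tnth y i) (Num.sqrt (2 * t)) (tnth x i).
Proof.
move=> t0.
have s0 : Num.sqrt (2 * t) != 0 by rewrite gt_eqF// sqrtr_gt0 mulr_gt0.
have s2 : Num.sqrt (2 * t) ^+ 2 = 2 * t by rewrite sqr_sqrtr// mulr_ge0// ltW.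
under eq_bigr do rewrite normal_pdfE// /normal_peak /normal_fun s2.
rewrite big_split/= prodr_const card_ord -expR_sum /heat_kernel; congr (_ * expR _).
  rewrite -(_ : 2 * t * pi *+ 2 = 4 * pi * t); last by rewrite -mulr_natl; ring.
  have pt0 : 0 <= 2 * t * pi *+ 2.
    by rewrite mulrn_wge0// !mulr_ge0 ?pi_ge0// ltW.
  rewrite -powR12_sqrt// -powRN -powR_mulrn ?powR_ge0// -powRrM; congr (_ `^ _).
  by rewrite mulNr mulrC.
rewrite enorm_sqr -sumrN mulr_suml; apply: eq_bigr => i _.
rewrite tnth_vsub; congr (_ / _).
by rewrite -mulr_natl; ring.
Qed.

Lemma integral_heat_kernel d (t : R) (y : euclid R d) : 0 < t ->
  (\int[lebesgue_euclid d]_x (heat_kernel t (vsub x y))%:E = 1)%E.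
Proof.
move=> t0; have s0 : Num.sqrt (2 * t) != 0 by rewrite gt_eqF// sqrtr_gt0 mulr_gt0.
under eq_integral do rewrite gaussian_prod//.
rewrite (@integral_prod_euclid d (fun i => normal_pdf (tnth y i) (Num.sqrt (2 * t)))).
- by apply: big1 => i _; rewrite integral_normal_pdf.
- by move=> i; exact: measurable_normal_pdf.
- by move=> i u; exact: normal_pdf_ge0.
Qed.

(** The l^1 norm is preferred in exponential weights because exp(- c |x|_1) is a product over the
    coordinates, and so is the Gaussian it is compared with. *)
Definition l1norm d (x : euclid R d) : R := \sum_(i < d) `|tnth x i|.

Lemma l1norm_ge0 d (x : euclid R d) : 0 <= l1norm x.
Proof. by apply: sumr_ge0. Qed.

Lemma measurable_l1norm d : measurable_fun [set: euclid R d] (@l1norm d).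
Proof.
apply: measurable_sum => i; apply: measurableT_comp => //.
exact: measurable_coord.
Qed.

Lemma l1norm_le_sub d (x y : euclid R d) : l1norm y <= l1norm x + l1norm (vsub x y).
Proof.
rewrite -big_split/=; apply: ler_sum => i _; rewrite tnth_vsub.
by rewrite addrC -lerBlDr (le_trans (lerB_dist _ _))// distrC.
Qed.

Lemma enorm_le_l1norm d (x : euclid R d) : enorm x <= l1norm x.
Proof.
rewrite -[leRHS]ger0_norm ?l1norm_ge0// -sqrtr_sqr ler_wsqrtr//.
rewrite expr2 {1}/l1norm mulr_suml; apply: ler_sum => i _.
rewrite -real_normK ?num_real// expr2 ler_wpM2l// /l1norm (bigD1 i)//= lerDl.
exact: sumr_ge0.
Qed.

(** The integrand is even, and on the half-line it is 1/c times the exponential density. *)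
Lemma integral_exp_abs (c : R) : 0 < c ->
  (\int[@lebesgue_measure R]_u (expR (- (c * `|u|)))%:E = (2 / c)%:E)%E.
Proof.
move=> c0.
rewrite ge0_symfun_integralT; first last.
- by move=> u /=; rewrite normrN.
- move=> u; apply: continuous_comp; last exact: continuous_expR.
  apply: continuousN; apply: continuousM; first exact: cst_continuous.
  exact: norm_continuous.
- by move=> u; exact: expR_ge0.
rewrite EFinM; congr (_ * _)%E.
have H := integral_exponential_pdf c0.
have {}H : (\int[@lebesgue_measure R]_(x in [set x | (0 <= x)%R])
    (c%:E * (expR (- (c * `|x|)))%:E) = 1)%E.
  rewrite -H [in LHS]integral_mkcond; apply: eq_integral => u _.
  rewrite patchE /exponential_pdf patchE.
  have -> : (u \in [set x : R | 0 <= x]) = (u \in `[0, +oo[%classic).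
    by apply/idP/idP; rewrite !inE/= in_itv/= andbT.
  case: ifPn => //; rewrite inE/= in_itv/= andbT => u0.
  by rewrite ger0_norm// mulNr.
move: H; rewrite ge0_integralZl//; first last.
- by rewrite lee_fin ltW.
- apply/measurable_EFinP; apply: measurable_funTS; apply: measurableT_comp => //.
  apply: measurableT_comp => //; apply: measurable_funM => //.
- rewrite -set_itvcy; exact: measurable_itv.
move=> H.
have : (c^-1%:E * (c%:E * \int[@lebesgue_measure R]_(x in [set x | (0 <= x)%R])
    (expR (- (c * `|x|)))%:E) = c^-1%:E)%E by rewrite H mule1.
by rewrite muleA -EFinM mulVf ?gt_eqF// mul1e.
Qed.

Lemma integral_exp_l1norm d (c : R) : 0 < c ->
  (\int[lebesgue_euclid d]_x (expR (- (c * l1norm x)))%:E = ((2 / c) ^+ d)%:E)%E.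
Proof.
move=> c0.
have E (x : euclid R d) :
    expR (- (c * l1norm x)) = \prod_(i < d) expR (- (c * `|tnth x i|)).
  by rewrite -expR_sum /l1norm mulr_sumr sumrN.
under eq_integral do rewrite E.
rewrite (@integral_prod_euclid d (fun=> fun u => expR (- (c * `|u|)))).
- under eq_bigr do rewrite integral_exp_abs//.
  by rewrite prodEFin prodr_const card_ord.
- move=> _; apply: measurableT_comp => //; apply: measurableT_comp => //.
  exact: measurable_funM.
- by move=> _ u; exact: expR_ge0.
Qed.

End euclid_integrals.

(** * Weak-type bounds for power weights and smoothing by the heat kernel *)

Section weak_euclid.
Context (R : realType) (d : nat).
Hypothesis d_gt0 : (0 < d)%N.
Local Notation lebE := (lebesgue_euclid d).
Implicit Types (x y : euclid R d) (F g : euclid R d -> R).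

Let dR0 : 0 < d%:R :> R. Proof. by rewrite ltr0n. Qed.

(* O'Neil's product rule: the two factors are cut at heights [rho] and [eta] for
   which both superlevel sets have measure of order [l `^ (- p)]. *)
Lemma weak_type_enorm_mul g (k m p q K : R) :
    0 <= k -> 0 < m -> 0 < q -> 0 < p -> p^-1 = k / d%:R + m / q ->
    measurable_fun setT g -> (forall x, 0 <= g x) -> weak_type lebE q K g ->
  weak_type lebE p (2 ^+ d + K) (fun x => enorm x `^ (- k) * g x `^ m).
Proof.
move=> k0 m0 q0 p0 pE mg g0 wg l l0.
pose rho := l `^ (- p / d%:R); pose eta := l `^ (p / q).
have rho0 : 0 < rho by exact: powR_gt0.
have eta0 : 0 < eta by exact: powR_gt0.
apply: (@le_trans _ _ (lebE ([set x | (enorm x < rho)%R] `|` [set x | (eta < g x)%R]))).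
  apply: le_measure; rewrite ?inE.
  - apply: measurable_gt_fun; apply: measurable_funM.
      exact: (measurableT_comp (measurable_powR (- k)) (@measurable_enorm R d)).
    exact: (measurableT_comp (measurable_powR m) mg).
  - by apply: measurableU; [exact: measurable_enorm_lt|exact: measurable_gt_fun].
  move=> x /= lF; have [|rx] := ltP (enorm x) rho; first by left.
  have [|gx] := ltP eta (g x); first by right.
  exfalso; move: lF; rewrite ltNge => /negP; apply.
  have e0 : 0 < enorm x by exact: lt_le_trans rx.
  (* This is the relation 1/p = k/d + m/q read on the exponents of l. *)
  have -> : l = rho `^ (- k) * eta `^ m.
    rewrite -!powRrM -powRD; last by rewrite (gt_eqF l0) implybT.
    rewrite -[LHS](powRr1 (ltW l0)); congr (_ `^ _).
    transitivity (p * (k / d%:R + m / q)); last by field; rewrite !gt_eqF.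
    by rewrite -pE mulfV// gt_eqF.
  rewrite ler_pM ?powR_ge0//.
    by rewrite !powRN lef_pV2 ?posrE ?powR_gt0// ge0_ler_powR// nnegrE ltW.
  by rewrite ge0_ler_powR ?nnegrE// ltW.
apply: (le_trans (measureU2 _ _ _)).
- exact: measurable_enorm_lt.
- exact: measurable_gt_fun.
apply: (le_trans (leeD (enorm_ball_measure d rho0) (wg _ eta0))).
rewrite -EFinD lee_fin le_eqVlt; apply/orP; left; apply/eqP.
rewrite [RHS]mulrDl exprMn; congr (_ * _ + _ * _).
  rewrite -powR_mulrn ?powR_ge0// -powRrM; congr (_ `^ _).
  by field; rewrite gt_eqF.
by rewrite -powRrM; congr (_ `^ _); field; rewrite gt_eqF.
Qed.

Lemma weak_type_enorm (k : R) : 0 < k ->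
  weak_type lebE (d%:R / k) (2 ^+ d) (fun x => enorm x `^ (- k)).
Proof.
move=> k0 l l0.
have r0 : 0 < l `^ (- k^-1) by exact: powR_gt0.
apply: (@le_trans _ _ (lebE [set x | (enorm x < l `^ (- k^-1))%R])).
  apply: le_measure; rewrite ?inE.
  - apply: measurable_gt_fun.
    exact: (measurableT_comp (measurable_powR (- k)) (@measurable_enorm R d)).
  - exact: measurable_enorm_lt.
  move=> x /= lx; have [->//|e0] := eqVneq (enorm x) 0.
  by apply: ltr_powR_neg_inv => //; rewrite lt_def e0 enorm_ge0.
apply: (le_trans (enorm_ball_measure d r0)); rewrite lee_fin exprMn.
rewrite -[X in _ * X <= _]powR_mulrn ?powR_ge0// -powRrM.
by rewrite (_ : - k^-1 * _ = - (d%:R / k))//; field; rewrite gt_eqF.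
Qed.

(** The mass of |x|^(-k) on a set depends only on the measure of the set, as [layer_cake_lorentz]
    requires of its weight. The reason is that |x|^(-k) is of weak type d/k > 1; k = 0, where d/k
    makes no sense, is the measure itself. *)
Lemma integral_enorm_le (k : R) : 0 <= k -> k < d%:R ->
  exists2 A, 0 <= A & forall E m, measurable E -> lebE E = m%:E ->
    (\int[lebE]_x (enorm x `^ (- k) * \1_E x)%:E <= (A * m `^ (1 - k / d%:R))%:E)%E.
Proof.
rewrite le_eqVlt => /predU1P[<- _|k0 kd].
  exists 1 => // E m mE Em; rewrite mul0r subr0 mul1r.
  have m0 : 0 <= m by rewrite -lee_fin -Em measure_ge0.
  rewrite powRr1// -Em; under eq_integral do rewrite oppr0 powRr0 mul1r.
  by rewrite integral_indic// setIT.
have p1 : 1 < d%:R / k by rewrite ltr_pdivlMr// mul1r.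
set c := weak_const (d%:R / k) * 2 ^+ d.
have c0 : 0 <= c by rewrite mulr_ge0// weak_const_ge0.
exists (1 + c) => [|E m mE Em]; first by rewrite addr_ge0.
have m0 : 0 <= m by rewrite -lee_fin -Em measure_ge0.
have mW : measurable_fun setT (fun x : euclid R d => enorm x `^ (- k)).
  exact: (measurableT_comp (measurable_powR (- k)) (@measurable_enorm R d)).
have e0 : 0 < 1 - k / d%:R by rewrite subr_gt0 ltr_pdivrMr// mul1r.
(* Null sets are treated apart: for m = 0 the level [L] below would not be positive. *)
move: m0; rewrite le_eqVlt => /predU1P[m0|m0].
  rewrite -m0 powR0 ?gt_eqF// mulr0.
  rewrite (ge0_ae_eq_integral (g := fun=> 0%E))//.
  - by rewrite integral0.
  - by apply/measurable_EFinP; apply: measurable_funM => //; exact: measurable_indic.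
  - by move=> x _; rewrite lee_fin mulr_ge0 ?powR_ge0.
  exists E; split => //; first by apply: etrans Em _; rewrite -m0.
  move=> x /= H; apply: contrapT => nE; apply: H => _.
  by rewrite indicE memNset// mulr0.
(* This level balances L m against L^(1 - d/k); both equal m^(1 - k/d). *)
pose L := m `^ (- (k / d%:R)).
have L0 : 0 < L by exact: powR_gt0.
have := @weak_type_integral _ _ R lebE (fun x : euclid R d => enorm x `^ (- k)) (\1_E)
  _ _ L p1 (exprn_ge0 d (ler0n R 2)) L0 mW.
have mI : measurable_fun setT (\1_E : euclid R d -> R) by exact: measurable_indic.
move=> /(_ (fun x => powR_ge0 _ _) mI).
move=> /(_ _ (weak_type_enorm k0)) => H; apply: (le_trans (H _)).
  by move=> x; rewrite indicE; case: (_ \in _); rewrite ?ler01 ?lexx.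
have -> : (\int[lebE]_x (\1_E x)%:E = m%:E)%E.
  by rewrite integral_indic// setIT; exact: Em.
rewrite -EFinM -EFinD lee_fin.
rewrite le_eqVlt; apply/orP; left; apply/eqP; rewrite mulrDl; congr (_ + _).
  rewrite mul1r addrC powRD; last by rewrite (gt_eqF m0) implybT.
  by rewrite powRr1// ltW.
rewrite -/c -powRrM; congr (_ * _ `^ _); field.
by rewrite !gt_eqF.
Qed.

(* Endpoint of Hoelder's inequality: [enorm x `^ (- k)] is only weakly integrable to
   the dual power, so the second Lorentz index [r] has to be at most [a]. *)
Lemma critical_integral (q r a k M : R) : 0 < r -> r < a -> 1 <= a -> a <= q ->
    0 <= k -> k / d%:R = 1 - a / q -> 0 <= M ->
  exists2 C, 0 <= C & forall f : euclid R d -> R[i], cmeasurable setT f ->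
    (lorentz_norm lebE q%:E r%:E f <= M%:E)%E ->
    (\int[lebE]_x (enorm x `^ (- k) * normc (f x) `^ a)%:E <= C%:E)%E.
Proof.
move=> r0 ra a1 aq k0 kE M0.
have a0 := lt_le_trans ltr01 a1; have q0 := lt_le_trans a0 aq.
have e0 : 0 < a / q by exact: divr_gt0.
have kd : k < d%:R.
  by rewrite -(mul1r d%:R) -ltr_pdivrMr// kE ltrBlDr ltrDl.
have [A A0 HA] := integral_enorm_le k0 kd.
have [B B0 HB] := lorentz_embedding lebE q0 r0 ra M0.
have [K K0 HK] := @lorentz_weak_type _ _ _ lebE q r%:E M q0 r0 M0.
have [D D0 HD] := @rearrangement_bound _ _ _ lebE q r%:E M q0 r0 M0.
exists (2 `^ a * (A * 2) * B); first by rewrite !mulr_ge0// powR_ge0.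
move=> f mf fM.
apply: (@le_trans _ _ ((2 `^ a * (A * 2))%:E *
  \int[@lebesgue_measure R]_(t in `]0%R, +oo[)
    (t `^ (a / q - 1) * fine (rearrangement lebE f t) `^ a)%:E)%E); last first.
  rewrite [leRHS]EFinM lee_wpmul2l ?lee_fin ?mulr_ge0 ?powR_ge0//.
  exact: HB.
apply: layer_cake_lorentz => //.
- by rewrite ler_pdivrMr// mul1r.
- exact: (measurableT_comp (measurable_powR (- k)) (@measurable_enorm R d)).
- by move=> x; exact: powR_ge0.
- move=> l l0; apply: le_lt_trans (HK f mf fM l l0) _; exact: ltry.
- move=> t t0; apply: le_lt_trans (HD f fM t t0) _; exact: ltry.
- by move=> E m mE Em; rewrite (_ : a / q = 1 - k / d%:R) ?HA// kE opprB addrC subrK.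
Qed.

(* From [`|z| <= 2 * t + z ^+ 2 / (8 * t)] in each coordinate. *)
Lemma heat_kernel_absorb (t T : R) x : 0 < t -> t <= T ->
  expR (l1norm x) * heat_kernel t x <=
  expR (2 * T * d%:R) * 2 `^ (d%:R / 2) * heat_kernel (2 * t) x.
Proof.
move=> t0 tT; rewrite /heat_kernel !enorm_sqr.
have pt0 : 0 <= 4 * pi * t by rewrite !mulr_ge0 ?pi_ge0// ltW.
have -> : 4 * pi * (2 * t) = 2 * (4 * pi * t) :> R by ring.
rewrite [(2 * _) `^ _]powRM//.
have E2 : 2 `^ (d%:R / 2) * 2 `^ (- (d%:R / 2)) = 1 :> R.
  by rewrite -powRD ?subrr ?powRr0// pnatr_eq0 implybT.
set P := (4 * pi * t) `^ _.
have P0 : 0 <= P by exact: powR_ge0.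
set S := \sum_(i < d) _.
have -> : expR (2 * T * d%:R) * 2 `^ (d%:R / 2) *
    (2 `^ (- (d%:R / 2)) * P * expR (- S / (4 * (2 * t)))) =
    P * (expR (2 * T * d%:R + - S / (4 * (2 * t)))).
  rewrite expRD; set u := 2 `^ (d%:R / 2) in E2 *; set v := 2 `^ (- _) in E2 *.
  set g1 := expR _; set g2 := expR _.
  by transitivity (u * v * (P * (g1 * g2))); [ring|rewrite E2 mul1r].
rewrite mulrCA ler_wpM2l// -expRD ler_expR.
have key : l1norm x <= 2 * T * d%:R + S / (8 * t).
  have -> : 2 * T * d%:R = \sum_(i < d) 2 * T.
    by rewrite sumr_const card_ord mulr_natr.
  rewrite /S mulr_suml -big_split/=; apply: ler_sum => i _.
  apply: (@le_trans _ _ (2 * t + tnth x i ^+ 2 / (8 * t))); last first.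
    by rewrite lerD2r ler_wpM2l.
  rewrite -subr_ge0 -(real_normK (num_real (tnth x i))).
  set z := `|tnth x i|.
  rewrite (_ : _ - _ = (z - 4 * t) ^+ 2 / (8 * t)); last by field; rewrite gt_eqF.
  by rewrite divr_ge0 ?sqr_ge0// mulr_ge0// ltW.
have -> : - S / (4 * t) = - (S / (8 * t)) - S / (8 * t) by field; rewrite gt_eqF.
have -> : - S / (4 * (2 * t)) = - (S / (8 * t)) by field; rewrite gt_eqF.
rewrite addrA lerD2r; move: key; rewrite -lerBlDr; exact.
Qed.

Lemma heat_kernel_sym (t : R) x y : heat_kernel t (vsub x y) = heat_kernel t (vsub y x).
Proof.
rewrite /heat_kernel !enorm_sqr.
rewrite (eq_bigr (fun i => tnth (vsub y x) i ^+ 2))// => i _.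
by rewrite !tnth_vsub -sqrrN opprB.
Qed.

Lemma l1norm_sym x y : l1norm (vsub x y) = l1norm (vsub y x).
Proof. by apply: eq_bigr => i _; rewrite !tnth_vsub distrC. Qed.

Lemma measurable_vsub_coord y i :
  measurable_fun setT (fun x : euclid R d => tnth (vsub x y) i).
Proof.
under eq_fun do rewrite tnth_vsub.
by apply: measurable_funB => //; exact: measurable_coord.
Qed.

Lemma measurable_gaussian (t : R) y :
  measurable_fun setT (fun x : euclid R d => expR (- enorm (vsub x y) ^+ 2 / t)).
Proof.
apply: measurableT_comp => //; apply: measurable_funM => //.
apply: measurableT_comp => //.
under eq_fun do rewrite enorm_sqr.
by apply: measurable_sum => i; apply: measurable_funX; exact: measurable_vsub_coord.
Qed.

Lemma measurable_l1norm_vsub y :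
  measurable_fun setT (fun x : euclid R d => l1norm (vsub x y)).
Proof.
apply: measurable_sum => i; apply: measurableT_comp => //.
exact: measurable_vsub_coord.
Qed.

(** The weak L^p to L^oo smoothing estimate, with an exponential factor to spare. After
    [heat_kernel_absorb] the kernel is a Gaussian [G * k] at time 2 t, with k <= 1, total mass 1 and
    [G] of order t^(-d/2); so truncation at level [L] gives a bound of order L + G L^(1-p). *)
Lemma weak_type_heat (p K T : R) : 1 < p -> 0 <= K -> 0 < T ->
  exists2 C, 0 <= C & forall F, measurable_fun setT F -> (forall x, 0 <= F x) ->
    weak_type lebE p K F -> forall t y, 0 < t -> t <= T ->
    (\int[lebE]_x (F x * (expR (l1norm (vsub x y)) * heat_kernel t (vsub x y)))%:E
      <= (C * t `^ (- (d%:R / (2 * p))))%:E)%E.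
Proof.
move=> p1 K0 T0.
have p0 := lt_trans ltr01 p1.
set c := weak_const p * K.
have c0 : 0 <= c by rewrite mulr_ge0// weak_const_ge0.
set B := expR (2 * T * d%:R) * 2 `^ (d%:R / 2).
have B0 : 0 <= B by rewrite mulr_ge0 ?expR_ge0 ?powR_ge0.
pose H := (8 * pi) `^ (- (d%:R / 2)) : R.
have H0 : 0 <= H by exact: powR_ge0.
exists (B * (1 + H * c)).
  by rewrite mulr_ge0// addr_ge0// mulr_ge0.
move=> F mF F0 wF t y t0 tT.
pose k x := expR (- enorm (vsub x y) ^+ 2 / (4 * (2 * t))).
have mk : measurable_fun setT k by exact: measurable_gaussian.
have t20 : 0 < 2 * t by rewrite mulr_gt0.
have k01 x : 0 <= k x <= 1.
  rewrite expR_ge0/= -[leRHS]expR0 ler_expR mulNr oppr_le0 divr_ge0 ?sqr_ge0//.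
  by rewrite mulr_ge0// ltW.
pose G := (4 * pi * (2 * t)) `^ (- (d%:R / 2)) : R.
have G0 : 0 < G by rewrite powR_gt0// !mulr_gt0 ?pi_gt0.
have GE : G = H * t `^ (- (d%:R / 2)).
  rewrite /G /H -powRM ?mulr_ge0 ?pi_ge0 ?(ltW t0)//; congr (_ `^ _); ring.
have Gk : (G%:E * \int[lebE]_x (k x)%:E = 1)%E.
  rewrite -(integral_heat_kernel y t20) -ge0_integralZl ?lee_fin ?(ltW G0)//.
  - exact/measurable_EFinP.
  - by move=> x _; rewrite lee_fin expR_ge0.
(* For this level [L] and G L^(1-p) are both of order t^(-d/(2p)). *)
pose L := t `^ (- (d%:R / (2 * p))).
have L0 : 0 < L by exact: powR_gt0.
apply: (@le_trans _ _ (\int[lebE]_x ((B * G)%:E * (F x * k x)%:E))%E).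
  apply: ge0_le_integral => //.
  - by move=> x _; rewrite lee_fin !mulr_ge0 ?expR_ge0 ?powR_ge0.
  - apply/measurable_EFinP; apply: measurable_funM => //; apply: measurable_funM.
      by apply: measurableT_comp => //; exact: measurable_l1norm_vsub.
    by apply: measurable_funM => //; exact: measurable_gaussian.
  - by apply: measurable_funeM; apply/measurable_EFinP; exact: measurable_funM.
  - move=> x _; rewrite -EFinM lee_fin [leRHS]mulrCA ler_wpM2l//.
    by apply: (le_trans (heat_kernel_absorb _ t0 tT)); rewrite -/B /heat_kernel mulrA.
rewrite ge0_integralZl//; last 3 first.
- by apply/measurable_EFinP; exact: measurable_funM.
- by move=> x _; rewrite lee_fin mulr_ge0//; case/andP: (k01 x).
- by rewrite lee_fin mulr_ge0// ltW.
have := weak_type_integral p1 K0 L0 mF F0 mk k01 wF.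
move=> /(lee_wpmul2l (_ : 0 <= (B * G)%:E)%E); rewrite lee_fin.
move=> /(_ (mulr_ge0 B0 (ltW G0)))/le_trans; apply.
rewrite muleDr ?fin_num_adde_defl ?fin_num_adde_defr//.
rewrite muleA -[in X in (X + _)%E]EFinM (_ : B * G * L = B * L * G); last by ring.
rewrite EFinM -muleA Gk mule1 -EFinM -EFinD lee_fin.
rewrite le_eqVlt; apply/orP; left; apply/eqP.
rewrite GE -/c.
have -> : L `^ (1 - p) = L * t `^ (d%:R / 2).
  rewrite /L -powRrM -powRD ?(gt_eqF t0) ?implybT//; congr (_ `^ _).
  by field; rewrite gt_eqF.
rewrite -/L.
have -> : B * (H * t `^ (- (d%:R / 2))) * (c * (L * t `^ (d%:R / 2))) =
   B * (H * c) * L * (t `^ (- (d%:R / 2)) * t `^ (d%:R / 2)) by ring.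
by rewrite -powRD ?addNr ?powRr0 ?(gt_eqF t0) ?implybT//; ring.
Qed.

End weak_euclid.

(** * Product spaces and the Schur test *)

Lemma ae_and d (X : measurableType d) (R : realType)
    (mu : {measure set X -> \bar R}) (P Q : X -> Prop) :
  (\forall x \ae mu, P x) -> (\forall x \ae mu, Q x) ->
  \forall x \ae mu, P x /\ Q x.
Proof. exact: filterI. Qed.

Lemma ae_imp d (X : measurableType d) (R : realType)
    (mu : {measure set X -> \bar R}) (P Q : X -> Prop) :
  (forall x, P x -> Q x) -> (\forall x \ae mu, P x) -> \forall x \ae mu, Q x.
Proof. by move=> PQ; exact: filterS. Qed.

(** The measure of the sections of a null set is nonnegative with integral 0, hence vanishes almost
    everywhere. *)
Lemma ae_prod_sections d1 d2 (X : measurableType d1) (Y : measurableType d2)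
    (R : realType) (m1 : {sigma_finite_measure set X -> \bar R})
    (m2 : {sigma_finite_measure set Y -> \bar R}) (P : X * Y -> Prop) :
  (\forall z \ae (m1 \x m2)%E, P z) ->
  \forall x \ae m1, \forall y \ae m2, P (x, y).
Proof.
move=> [N [mN N0 PN]].
have mx : measurable_fun setT (fun x => m2 (xsection N x)).
  exact: measurable_fun_xsection.
have : (\int[m1]_(x in setT) `|m2 (xsection N x)| = 0)%E.
  by rewrite -[RHS]N0; apply: eq_integral => x _; rewrite gee0_abs.
move=> /(ae_eq_integral_abs m1 measurableT mx); apply: filterS => x /(_ Logic.I)/= Nx.
exists (xsection N x); split => //; first exact: measurable_xsection.
by move=> y /= Py; rewrite /xsection/= inE; exact: PN.
Qed.

Lemma ae_prod_snd d1 d2 (X : measurableType d1) (Y : measurableType d2)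
    (R : realType) (m1 : {sigma_finite_measure set X -> \bar R})
    (m2 : {sigma_finite_measure set Y -> \bar R}) (P : Y -> Prop) :
  (\forall y \ae m2, P y) -> \forall z \ae (m1 \x m2)%E, P z.2.
Proof.
move=> [N [mN N0 PN]]; exists (setT `*` N); split.
- exact: measurableX.
- by rewrite product_measure1E// [X in (_ * X)%E]N0 mule0.
- by move=> z /= Pz; split => //=; exact: PN.
Qed.

Section product_sigma_finite.
Context d1 d2 (X : measurableType d1) (Y : measurableType d2) (R : realType)
  (m1 : {sigma_finite_measure set X -> \bar R})
  (m2 : {sigma_finite_measure set Y -> \bar R}).

(** The Schur test applies Tonelli to pairs of space-time points, so space-time with its product
    measure must itself be a sigma-finite factor. *)
Lemma sigma_finite_product : sigma_finite setT (m1 \x m2)%E.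
Proof.
have /sigma_finiteP[F [FT ndF fF]] := sigma_finiteT m1.
have /sigma_finiteP[G [GT ndG fG]] := sigma_finiteT m2.
exists (fun k => F k `*` G k).
  apply/seteqP; split => // -[x y] _.
  have [i _ Fi] : (\bigcup_i F i) x by rewrite -FT.
  have [j _ Gj] : (\bigcup_j G j) y by rewrite -GT.
  exists (maxn i j) => //; split.
    by move: x Fi; exact/subsetPset/ndF/leq_maxl.
  by move: y Gj; exact/subsetPset/ndG/leq_maxr.
move=> k; have [mF Fk] := fF k; have [mG Gk] := fG k; split.
  exact: measurableX.
by rewrite product_measure1E// lte_mul_pinfty// ge0_fin_numE.
Qed.

Definition product_sigma_finite_measure : {sigma_finite_measure set (X * Y)%type -> \bar R} :=
  HB.pack_for {sigma_finite_measure set (X * Y)%type -> \bar R} (m1 \x m2)%E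
    (Measure_isSigmaFinite.Build _ _ _ (m1 \x m2)%E sigma_finite_product).
End product_sigma_finite.

(** Multiplying the inequality for F by [rho], integrating and exchanging the integrals leaves the
    column integral of the kernel, which is at most rho/2; thus the weighted integral J of F
    satisfies J <= J/2. Only columns occur, as the norm of F is of L^1 type. *)
Lemma schur_vanish d (Z : measurableType d) (R : realType)
    (mu : {sigma_finite_measure set Z -> \bar R})
    (F W rho : Z -> R) (k : Z * Z -> R) :
    measurable_fun setT F -> measurable_fun setT W -> measurable_fun setT rho ->
    measurable_fun setT k ->
    (forall z, 0 <= F z) -> (forall z, 0 <= W z) -> (forall z, 0 < rho z) ->
    (forall z, 0 <= k z) ->
    (\forall z \ae mu, ((F z)%:E <= (W z)%:E * \int[mu]_z' (k (z, z') * F z')%:E)%E) ->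
    (forall z', (\int[mu]_z (rho z * W z * k (z, z'))%:E <= (rho z' / 2)%:E)%E) ->
    (\int[mu]_z (rho z * F z)%:E < +oo)%E ->
  \forall z \ae mu, F z = 0.
Proof.
move=> mF mW mrho mk F0 W0 rho0 k0 Fle Hk fin.
pose H (w : Z * Z) : \bar R := (rho w.1 * W w.1 * k w * F w.2)%:E.
have mH : measurable_fun setT H.
  apply/measurable_EFinP; apply: measurable_funM.
    apply: measurable_funM => //; apply: measurable_funM.
      exact: (measurableT_comp mrho).
    exact: (measurableT_comp mW).
  exact: (measurableT_comp mF).
have H0 w : (0 <= H w)%E by rewrite lee_fin !mulr_ge0// ltW.
have mrF : measurable_fun setT (fun z => (rho z * F z)%:E).
  by apply/measurable_EFinP; exact: measurable_funM.
have rF0 z : (0 <= (rho z * F z)%:E)%E by rewrite lee_fin mulr_ge0// ltW.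
have J0 : (0 <= \int[mu]_z (rho z * F z)%:E)%E by exact: integral_ge0.
have half : (\int[mu]_z (rho z * F z)%:E <= (2^-1)%:E * \int[mu]_z (rho z * F z)%:E)%E.
  apply: (@le_trans _ _ (\int[mu]_z \int[mu]_z' H (z, z'))%E).
    apply: ae_ge0_le_integral => //.
    - by move=> z _; exact: integral_ge0.
    - exact: (measurable_fun_fubini_tonelli_F (m2 := mu) H mH H0).
    apply: filterS Fle => z Fz _.
    have -> : (\int[mu]_z' H (z, z') =
        (rho z * W z)%:E * \int[mu]_z' (k (z, z') * F z')%:E)%E.
      rewrite -ge0_integralZl//.
      - by apply: eq_integral => z' _; rewrite /H/= -EFinM mulrA.
      - apply/measurable_EFinP; apply: measurable_funM => //.
        exact: (measurable_fun_pair2 z mk).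
      - by move=> z' _; rewrite lee_fin mulr_ge0.
      - by rewrite lee_fin mulr_ge0// ltW.
    by rewrite [leLHS]EFinM (EFinM (rho z) (W z)) -muleA lee_wpmul2l// lee_fin ltW.
  have -> : (\int[mu]_z \int[mu]_z' H (z, z') = \int[mu]_z' \int[mu]_z H (z, z'))%E.
    exact: (fubini_tonelli (m1 := mu) (m2 := mu) H mH H0).
  rewrite -ge0_integralZl//.
  apply: ge0_le_integral => //.
  - by move=> z _; exact: integral_ge0.
  - exact: (measurable_fun_fubini_tonelli_G (m1 := mu) H mH H0).
  - exact: measurable_funeM.
  move=> z' _.
  have -> : (\int[mu]_z H (z, z') =
      (\int[mu]_z (rho z * W z * k (z, z'))%:E) * (F z')%:E)%E.
    rewrite -ge0_integralZr//.
    - apply/measurable_EFinP; apply: measurable_funM; first exact: measurable_funM.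
      exact: (measurable_fun_pair1 z' mk).
    - by move=> z _; rewrite lee_fin !mulr_ge0// ltW.
    - by rewrite lee_fin.
  rewrite -EFinM (_ : 2^-1 * _ = rho z' / 2 * F z'); last by ring.
  by rewrite EFinM lee_wpmul2r// lee_fin.
have Jz : (\int[mu]_z (rho z * F z)%:E = 0)%E.
  (* J <= J/2 also holds for J = +oo, which the finiteness hypothesis excludes. *)
  move: half fin J0; case: (\int[mu]_z _)%E => [j| |]//.
  rewrite -EFinM !lee_fin => jh _ j0; congr EFin; apply/eqP.
  rewrite eq_le j0 andbT; move: jh; lra.
have /(ae_eq_integral_abs mu measurableT mrF) : (\int[mu]_(z in setT) `|(rho z * F z)%:E| = 0)%E.
  by rewrite -[RHS]Jz; apply: eq_integral => z _; rewrite gee0_abs.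
apply: filterS => z /(_ Logic.I)/= [] /eqP.
by rewrite mulf_eq0 gt_eqF//= => /eqP.
Qed.

(** * Complex integrals and differences of powers *)

Section cintegral_bounds.
Context d (X : measurableType d) (R : realType).
Variables (mu : {measure set X -> \bar R}) (D : set X).
Hypothesis mD : measurable D.
Implicit Types f g : X -> R[i].

Lemma normc_ReIm (z : R[i]) : normc z <= `|complex.Re z| + `|complex.Im z|.
Proof.
case: z => a b /=; rewrite -[leRHS]ger0_norm ?addr_ge0// -sqrtr_sqr ler_wsqrtr//.
rewrite sqrrD !real_normK ?num_real// addrAC lerDl mulrn_wge0// mulr_ge0//.
Qed.

Lemma Re_le_normc (z : R[i]) : `|complex.Re z| <= normc z.
Proof. by case: z => a b /=; rewrite -sqrtr_sqr ler_wsqrtr// lerDl sqr_ge0. Qed.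

Lemma Im_le_normc (z : R[i]) : `|complex.Im z| <= normc z.
Proof. by case: z => a b /=; rewrite -sqrtr_sqr ler_wsqrtr// lerDr sqr_ge0. Qed.

Lemma normc_ge0 (z : R[i]) : 0 <= normc z.
Proof. by case: z => a b /=; exact: sqrtr_ge0. Qed.

Lemma normc_real (a : R) (z : R[i]) : 0 <= a -> normc (a%:C%C * z) = a * normc z.
Proof.
by move=> a0; rewrite normcM /= expr0n/= addr0 sqrtr_sqr ger0_norm.
Qed.

Lemma cintegrable_measurable f : cintegrable mu D f -> cmeasurable D f.
Proof. by move=> [/measurable_int/measurable_EFinP ? /measurable_int/measurable_EFinP ?]. Qed.

Lemma cintegrable_sub f g : cintegrable mu D f -> cintegrable mu D g ->
  cintegrable mu D (fun x => f x - g x).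
Proof.
move=> [f1 f2] [g1 g2]; split.
  rewrite (_ : EFin \o _ = (EFin \o (@complex.Re R \o f)) \- (EFin \o (@complex.Re R \o g)))%E.
    exact: integrableB.
  by apply/funext => x /=; case: (f x) => a b; case: (g x) => a' b'.
rewrite (_ : EFin \o _ = (EFin \o (@complex.Im R \o f)) \- (EFin \o (@complex.Im R \o g)))%E.
  exact: integrableB.
by apply/funext => x /=; case: (f x) => a b; case: (g x) => a' b'.
Qed.

Lemma cintegral_sub f g : cintegrable mu D f -> cintegrable mu D g ->
  cintegral mu D (fun x => f x - g x) = cintegral mu D f - cintegral mu D g.
Proof.
move=> [f1 f2] [g1 g2]; rewrite /cintegral.
have -> : \int[mu]_(x in D) complex.Re (f x - g x) =
    \int[mu]_(x in D) complex.Re (f x) - \int[mu]_(x in D) complex.Re (g x).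
  rewrite -RintegralB//; apply: eq_Rintegral => x _.
  by case: (f x) => a b; case: (g x) => a' b'.
have -> : \int[mu]_(x in D) complex.Im (f x - g x) =
    \int[mu]_(x in D) complex.Im (f x) - \int[mu]_(x in D) complex.Im (g x).
  rewrite -RintegralB//; apply: eq_Rintegral => x _.
  by case: (f x) => a b; case: (g x) => a' b'.
by [].
Qed.

(** The real and imaginary parts are estimated separately, whence the 2. A larger constant is
    harmless, because the Schur test absorbs any constant for [Lam] large. *)
Lemma normc_cintegral_le f : cintegrable mu D f ->
  ((normc (cintegral mu D f))%:E <= 2%:E * \int[mu]_(x in D) (normc (f x))%:E)%E.
Proof.
move=> [f1 f2].
have mN : measurable_fun D (fun x => (normc (f x))%:E).
  apply/measurable_EFinP; apply: (measurable_normc mD).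
  exact: cintegrable_measurable.
have le1 (h : X -> R) : mu.-integrable D (EFin \o h) ->
    (forall x, `|h x| <= normc (f x)) ->
    (`|\int[mu]_(x in D) h x|%:E <= \int[mu]_(x in D) (normc (f x))%:E)%E.
  move=> ih hf; apply: (@le_trans _ _ (\int[mu]_(x in D) `|(h x)%:E|)%E).
    rewrite EFin_normr_Rintegral//; apply: le_abse_integral => //.
    exact: (measurable_int _ ih).
  apply: ge0_le_integral => //.
  - by apply: measurableT_comp => //; exact: (measurable_int _ ih).
  - by move=> x _; rewrite lee_fin hf.
apply: (@le_trans _ _ (`|\int[mu]_(x in D) complex.Re (f x)|%:E +
    `|\int[mu]_(x in D) complex.Im (f x)|%:E)%E).
  by rewrite -EFinD lee_fin; exact: (normc_ReIm (cintegral mu D f)).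
rewrite (_ : 2%:E = 1 + 1)%E; last by rewrite -EFinD; congr EFin.
rewrite ge0_muleDl// !mul1e leeD//; apply: le1 => // x.
  exact: Re_le_normc.
exact: Im_le_normc.
Qed.

End cintegral_bounds.

Section power_difference.
Context (R : realType).
Implicit Types a b : R[i].

(** By homogeneity, with x = B/A <= 1, it suffices that (1 - x^be) x <= n (1 - x), and this follows
    from 1 - x^be <= 1 - x^n <= n (1 - x). The integer n above be lets Bernoulli's inequality, an
    induction, replace the mean value theorem. *)
Lemma powR_diff_le (n : nat) (be A B : R) : 0 < be -> be <= n%:R -> 0 <= B -> B <= A ->
  (A `^ be - B `^ be) * B <= n%:R * A `^ be * (A - B).
Proof.
move=> be0 ben B0 BA; have A0 := le_trans B0 BA.
move: B0; rewrite le_eqVlt => /predU1P[<-|B0].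
  by rewrite mulr0 subr0 !mulr_ge0// powR_ge0.
have A0' := lt_le_trans B0 BA.
pose x := B / A.
have x0 : 0 < x by rewrite divr_gt0.
have x1 : x <= 1 by rewrite ler_pdivrMr// mul1r.
have BE : B = A * x by rewrite /x mulrCA mulfV ?mulr1// gt_eqF.
have -> : (A `^ be - B `^ be) * B = A `^ be * A * ((1 - x `^ be) * x).
  by rewrite BE powRM ?(ltW x0)//; ring.
have -> : n%:R * A `^ be * (A - B) = A `^ be * A * (n%:R * (1 - x)).
  by rewrite BE; ring.
rewrite ler_wpM2l ?mulr_ge0 ?powR_ge0//.
have xb : x ^+ n <= x `^ be.
  by rewrite -powR_mulrn ?(ltW x0)//; apply: ger_powR; rewrite ?x0 ?x1.
have bern : forall m : nat, 1 - x ^+ m <= m%:R * (1 - x).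
  elim => [|m IH]; first by rewrite expr0 subrr mul0r.
  have -> : 1 - x ^+ m.+1 = (1 - x ^+ m) + x ^+ m * (1 - x) by rewrite exprSr; ring.
  rewrite -natr1 mulrDl mul1r; apply: lerD => //.
  apply: ler_piMl; first by rewrite subr_ge0.
  by apply: exprn_ile1 => //; exact: ltW.
apply: (@le_trans _ _ (1 - x `^ be)).
  have : x `^ be <= 1 `^ be.
    by apply: ge0_ler_powR => //; rewrite ?nnegrE ?ler01 ?(ltW x0) ?(ltW be0).
  by rewrite powR1 => xb1; rewrite ler_piMr// subr_ge0.
by apply: (le_trans _ (bern n)); rewrite lerD2l lerN2.
Qed.

Lemma normc_sub_ge a b : normc a - normc b <= normc (a - b).
Proof. by rewrite lerBlDr; have := le_normcD (a - b) b; rewrite subrK. Qed.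

Lemma normc_subC a b : normc (a - b) = normc (b - a).
Proof. by rewrite -normcN opprB. Qed.

Lemma normc_power_diff (n : nat) (be : R) a b : 0 < be -> be <= n%:R ->
  normc ((normc a `^ be)%:C%C * a - (normc b `^ be)%:C%C * b) <=
  (n%:R + 1) * (normc a `^ be + normc b `^ be) * normc (a - b).
Proof.
move=> be0 ben.
wlog ba : a b / normc b <= normc a.
  move=> H; have [|/ltW] := leP (normc b) (normc a); first exact: H.
  by move=> /H; rewrite (normc_subC b a) (addrC (normc b `^ be)) -[leLHS]normcN opprB.
have -> : (normc a `^ be)%:C%C * a - (normc b `^ be)%:C%C * b =
    (normc a `^ be)%:C%C * (a - b) + (normc a `^ be - normc b `^ be)%:C%C * b.
  by rewrite rmorphB/=; ring.
apply: (le_trans (le_normcD _ _)).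
have dge : 0 <= normc a `^ be - normc b `^ be.
  by rewrite subr_ge0 ge0_ler_powR ?nnegrE ?normc_ge0 ?(ltW be0).
rewrite !normc_real ?powR_ge0//.
have h1 := powR_diff_le be0 ben (normc_ge0 b) ba.
have h2 : n%:R * normc a `^ be * (normc a - normc b) <= n%:R * normc a `^ be * normc (a - b).
  by rewrite ler_wpM2l ?mulr_ge0 ?powR_ge0// normc_sub_ge.
have h3 : 0 <= (n%:R + 1) * normc b `^ be * normc (a - b).
  by rewrite !mulr_ge0 ?powR_ge0 ?normc_ge0// addr_ge0.
have -> : (n%:R + 1) * (normc a `^ be + normc b `^ be) * normc (a - b) =
  normc a `^ be * normc (a - b) + (n%:R * normc a `^ be * normc (a - b)) +
  (n%:R + 1) * normc b `^ be * normc (a - b) by ring.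
rewrite -addrA lerD2l; apply: (le_trans h1); apply: (le_trans h2).
by rewrite lerDl.
Qed.

End power_difference.

(** * Growth of the free evolution and of the nonlinearity *)

(** Here iQ = 1/Q_c. Subcriticality clears denominators to d alpha - d - gamma < 2 alpha, which is
    the bound on d/2 (1 - iQ). The two signs, which make the remaining powers of |x| nonincreasing,
    have different sources: s >= gamma/(alpha - 1) for the first, and alpha <= q for the second,
    since the scaling turns s alpha - gamma into d (1 - alpha/q). *)
Lemma exponent_arithmetic (R : realType) (d : nat) (gamma alpha q s : R) :
    (0 < d)%N -> - Num.min 2 d%:R < gamma -> Num.max 1 (1 + gamma / d%:R) < alpha ->
    alpha <= q -> gamma / (alpha - 1) <= s ->
    s / d%:R + q^-1 = (Q_crit d gamma alpha)^-1 ->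
    (Q_crit d gamma alpha)^-1 < (q_crit d gamma alpha)^-1 ->
  exists iQ : R, [/\ 0 < iQ < 1, s / d%:R + q^-1 = iQ,
    d%:R / 2 * (1 - iQ) < 1, alpha * iQ = 1 + gamma / d%:R &
    0 <= s * (alpha - 1) - gamma /\ 0 <= s * alpha - gamma].
Proof.
move=> d0 gam alp aq sg sc sub.
have dR : 0 < d%:R :> R by rewrite ltr0n.
move: alp; rewrite gt_max => /andP[a1 ag].
have a0 : 0 < alpha by exact: lt_trans a1.
have b0 : 0 < alpha - 1 by rewrite subr_gt0.
have [g2 gd] : - 2 < gamma /\ - d%:R < gamma.
  move: gam; rewrite ltrNl lt_min => /andP[h1 h2]; split; lra.
have q0 : 0 < q by exact: lt_le_trans aq.
have dg : 0 < d%:R + gamma by lra.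
have ag' : d%:R + gamma < d%:R * alpha.
  move: ag; rewrite -(ltr_pM2l dR) mulrDr mulr1 mulrCA mulfV ?gt_eqF// mulr1//.
exists (Q_crit d gamma alpha)^-1.
have QE : (Q_crit d gamma alpha)^-1 = (d%:R + gamma) / (d%:R * alpha).
  by rewrite /Q_crit invf_div.
have aQ : alpha * (Q_crit d gamma alpha)^-1 = 1 + gamma / d%:R.
  by rewrite QE; field; rewrite !gt_eqF.
have k1 : 0 <= s * (alpha - 1) - gamma.
  by rewrite subr_ge0 -ler_pdivrMr.
split => //.
- rewrite QE divr_gt0 ?mulr_gt0//= ltr_pdivrMr ?mulr_gt0// mul1r//.
- have h : (d%:R + gamma) * (alpha - 1) < alpha * (2 + gamma).
    move: sub; rewrite QE /q_crit invf_div.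
    rewrite ltr_pdivrMr ?mulr_gt0// mulrAC ltr_pdivlMr ?mulr_gt0// => h.
    rewrite -(ltr_pM2l dR); move: h; lra.
  rewrite QE (_ : d%:R / 2 * (1 - _) = (d%:R * alpha - (d%:R + gamma)) / (2 * alpha)); last first.
    by field; rewrite !gt_eqF.
  rewrite ltr_pdivrMr ?mulr_gt0// mul1r; lra.
- split => //.
  have : 0 <= (1 - alpha / q) * d%:R.
    by rewrite mulr_ge0 ?(ltW dR)// subr_ge0 ler_pdivrMr// mul1r.
  suff -> : s * alpha - gamma = (1 - alpha / q) * d%:R by [].
  have -> : 1 - alpha / q = alpha * (s / d%:R + q^-1) - gamma / d%:R - alpha / q.
    by rewrite sc aQ addrK.
  by field; rewrite !gt_eqF.
Qed.

Lemma lorentz_norm_ge0 d (X : measurableType d) (R : realType)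
    (mu : {measure set X -> \bar R}) (q r : \bar R) (f : X -> R[i]) :
  (0 < r)%E -> (0 <= lorentz_norm mu q r f)%E.
Proof.
rewrite /lorentz_norm; case: r => [r| |]// _; first exact: poweR_ge0.
have I1 : `]0%R, +oo[%classic (1 : R) by rewrite /= in_itv/= ltr01.
apply: le_trans (ereal_sup_ubound (ex_intro2 _ _ 1 I1 erefl)).
by rewrite mule_ge0 ?lee_fin ?powR_ge0// rearrangement_ge0.
Qed.

Lemma cmeasurable_mulr d (X : measurableType d) (R : realType) (D : set X)
    (g : X -> R) (f : X -> R[i]) :
  measurable_fun D g -> cmeasurable D f ->
  cmeasurable D (fun x => (g x)%:C%C * f x).
Proof.
move=> mg [f1 f2]; split.
  rewrite (_ : _ \o _ = fun x => g x * complex.Re (f x)).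
    exact: measurable_funM.
  by apply/funext => x /=; case: (f x) => a b /=; rewrite mul0r subr0.
rewrite (_ : _ \o _ = fun x => g x * complex.Im (f x)).
  exact: measurable_funM.
by apply/funext => x /=; case: (f x) => a b /=; rewrite mul0r addr0.
Qed.

Lemma cmeasurable_sub d (X : measurableType d) (R : realType) (D : set X)
    (f g : X -> R[i]) :
  cmeasurable D f -> cmeasurable D g -> cmeasurable D (fun x => f x - g x).
Proof.
move=> [f1 f2] [g1 g2]; split.
  rewrite (_ : _ \o _ = fun x => complex.Re (f x) - complex.Re (g x)).
    exact: measurable_funB.
  by apply/funext => x /=; case: (f x) => a b; case: (g x).
rewrite (_ : _ \o _ = fun x => complex.Im (f x) - complex.Im (g x)).
  exact: measurable_funB.
by apply/funext => x /=; case: (f x) => a b; case: (g x).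
Qed.

(** * Weighted functions and pointwise growth of the free evolution *)

Section weighted.
Context (R : realType) (d : nat).
Hypothesis d_gt0 : (0 < d)%N.
Local Notation lebE := (lebesgue_euclid d).
Implicit Types (f : euclid R d -> R[i]).

Definition wabs (s : R) f (x : euclid R d) : R := enorm x `^ s * normc (f x).

Lemma wabs_ge0 s f x : 0 <= wabs s f x.
Proof. by rewrite mulr_ge0 ?powR_ge0 ?normc_ge0. Qed.

Lemma wabsE s f : @normc R \o (fun x => (enorm x `^ s)%:C%C * f x) = wabs s f.
Proof. by apply/funext => x /=; rewrite normc_real ?powR_ge0. Qed.

Lemma measurable_enorm_powR (s : R) :
  measurable_fun setT (fun x : euclid R d => enorm x `^ s).
Proof. exact: (measurableT_comp (measurable_powR s) (@measurable_enorm R d)). Qed.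

Lemma cmeasurable_weight s f : cmeasurable setT f ->
  cmeasurable setT (fun x => (enorm x `^ s)%:C%C * f x).
Proof. by apply: cmeasurable_mulr; exact: measurable_enorm_powR. Qed.

Lemma measurable_wabs s f : cmeasurable setT f -> measurable_fun setT (wabs s f).
Proof.
by move=> mf; rewrite -wabsE; apply: measurable_normc => //; exact: cmeasurable_weight.
Qed.

Lemma wlorentz_weak_type (s q : R) (r : \bar R) (M : R) : 0 < q -> (0 < r)%E -> 0 <= M ->
  exists2 K, 0 <= K & forall f, cmeasurable setT f ->
    (wlorentz_norm s q%:E r f <= M%:E)%E -> weak_type lebE q K (wabs s f).
Proof.
move=> q0 r0 M0; have [K K0 HK] := lorentz_weak_type lebE q0 r0 M0.
exists K => // f mf fM; rewrite -wabsE; apply: HK => //.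
exact: cmeasurable_weight.
Qed.

(** A sum exceeds l only if one of its terms exceeds l/2, whence 2^q. The weak scale is what allows
    f and g to come from Lorentz spaces with different second indices. *)
Lemma weak_type_sub (s q K1 K2 : R) f g : 0 < q -> 0 <= K1 -> 0 <= K2 ->
  cmeasurable setT f -> cmeasurable setT g ->
  weak_type lebE q K1 (wabs s f) -> weak_type lebE q K2 (wabs s g) ->
  weak_type lebE q (2 `^ q * (K1 + K2)) (wabs s (fun x => f x - g x)).
Proof.
move=> q0 K10 K20 mf mg wf wg l l0.
have l20 : 0 < l / 2 by rewrite divr_gt0.
have mwf := measurable_wabs s mf; have mwg := measurable_wabs s mg.
apply: (@le_trans _ _ (lebE ([set x | (l / 2 < wabs s f x)%R] `|` [set x | (l / 2 < wabs s g x)%R]))).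
  apply: le_measure; rewrite ?inE.
  - by apply: measurable_gt_fun; apply: measurable_wabs; exact: cmeasurable_sub.
  - by apply: measurableU; exact: measurable_gt_fun.
  move=> x /= lx; have [|fx] := ltP (l / 2) (wabs s f x); first by left.
  have [|gx] := ltP (l / 2) (wabs s g x); first by right.
  exfalso; move: lx; rewrite ltNge => /negP; apply.
  apply: (@le_trans _ _ (wabs s f x + wabs s g x)); last by lra.
  rewrite /wabs -mulrDr ler_wpM2l ?powR_ge0//.
  by rewrite (le_trans (le_normcD _ _))// normcN.
apply: (le_trans (measureU2 _ _ _)); [exact: measurable_gt_fun..|].
apply: (le_trans (leeD (wf _ l20) (wg _ l20))).
rewrite -EFinD lee_fin -mulrDl powRM ?(ltW l0) ?invr_ge0//.
have -> : 2^-1 `^ (- q) = 2 `^ q :> R.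
  by rewrite -powR_inv1// -powRrM mulN1r opprK.
by rewrite le_eqVlt; apply/orP; left; apply/eqP; ring.
Qed.

Lemma cintegrable_bounded d' (X : measurableType d') (mu : {measure set X -> \bar R})
    (f : X -> R[i]) :
  cmeasurable setT f -> (\int[mu]_x (normc (f x))%:E < +oo)%E ->
  cintegrable mu setT f.
Proof.
move=> mf fin; have mN : measurable_fun setT (fun x => (normc (f x))%:E).
  by apply/measurable_EFinP; exact: measurable_normc.
case: (mf) => mRe mIm; split; apply/integrableP; split.
- exact/measurable_EFinP.
- apply: le_lt_trans fin; apply: ge0_le_integral => //.
    by apply: measurableT_comp => //; exact/measurable_EFinP.
  by move=> x _; rewrite lee_fin Re_le_normc.
- exact/measurable_EFinP.
- apply: le_lt_trans fin; apply: ge0_le_integral => //.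
    by apply: measurableT_comp => //; exact/measurable_EFinP.
  by move=> x _; rewrite lee_fin Im_le_normc.
Qed.

(** The inequality a/m <= exp(a/m), raised to the power m. *)
Lemma powR_le_expR (m a : R) : 0 < m -> 0 <= a -> a `^ m <= m `^ m * expR a.
Proof.
move=> m0 a0; have am0 : 0 <= a / m by rewrite divr_ge0// ltW.
have -> : a `^ m = m `^ m * (a / m) `^ m.
  by rewrite -powRM ?(ltW m0)//; congr (_ `^ _); field; rewrite gt_eqF.
rewrite ler_wpM2l ?powR_ge0//.
have h : a / m <= expR (a / m) by rewrite (le_trans _ (expR_ge1Dx _))// lerDr.
have := @ge0_ler_powR _ m (ltW m0) _ _ _ _ h.
rewrite !nnegrE am0 expR_ge0 => /(_ isT isT)/le_trans; apply.
by rewrite -expRM mulfVK ?gt_eqF.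
Qed.

(** For s < 0 the inverse weight grows at infinity and has no weak-type bound; its growth is traded
    for an exponential, so that only a nonincreasing power of |x| remains. *)
Lemma inv_weight_le (s : R) : exists2 C, 0 <= C & forall x : euclid R d,
  enorm x `^ (- s) <= C * (expR (l1norm x) * enorm x `^ (- Num.max s 0)).
Proof.
have [s0|s0] := leP 0 s.
  exists 1 => // x; rewrite mul1r ler_peMl ?powR_ge0//.
  by rewrite -[leLHS]expR0 ler_expR l1norm_ge0.
exists ((- s) `^ (- s)) => [|x]; first exact: powR_ge0.
rewrite oppr0 powRr0 mulr1.
have ms0 : 0 < - s by rewrite oppr_gt0.
apply: (le_trans (powR_le_expR ms0 (enorm_ge0 x))).
by rewrite ler_wpM2l ?powR_ge0// ler_expR enorm_le_l1norm.
Qed.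

Lemma normc_wabs (s : R) f x : enorm x != 0 ->
  normc (f x) = enorm x `^ (- s) * wabs s f x.
Proof.
move=> x0; rewrite /wabs mulrA -powRD ?x0 ?implybT//.
by rewrite addNr powRr0 mul1r.
Qed.

(** Undoing the weight, |f| is at most an exponential times a function of weak type p0. The
    exponential at y is moved to x at the cost of exp |y - x|_1, the factor that [weak_type_heat]
    has to spare. Growth in x is allowed, because the weight exp(- |x|_1) is available later. *)
Lemma heat_growth (T s q : R) (r : \bar R) (p0 : R) f :
    0 < T -> 0 < q -> (0 < r)%E -> 1 < p0 -> p0^-1 = Num.max s 0 / d%:R + q^-1 ->
    wlorentz s q%:E r f ->
  exists2 C, 0 <= C & forall t x, 0 < t -> t <= T ->
    normc (heat t f x) <= C * t `^ (- (d%:R / (2 * p0))) * expR (l1norm x).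
Proof.
move=> T0 q0 r0 p1 pE [mf fin].
pose M := fine (wlorentz_norm s q%:E r f).
have nge0 : (0 <= wlorentz_norm s q%:E r f)%E.
  exact: lorentz_norm_ge0.
have ME : wlorentz_norm s q%:E r f = M%:E by rewrite fineK// ge0_fin_numE.
have M0 : 0 <= M by rewrite fine_ge0.
have [K K0 HK] := @wlorentz_weak_type s q r M q0 r0 M0.
have wf : weak_type lebE q K (wabs s f) by apply: HK => //; rewrite ME.
pose k0 := Num.max s 0; have k00 : 0 <= k0 by rewrite le_max lexx orbT.
have p00 := lt_trans ltr01 p1.
have mw := measurable_wabs s mf.
have wF := weak_type_enorm_mul d_gt0 k00 ltr01 q0 p00 (_ : p0^-1 = k0 / d%:R + 1 / q)
  mw (wabs_ge0 s f) wf.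
move: wF; rewrite div1r => /(_ pE).
set F := (fun x => _) => wF.
have KK0 : 0 <= 2 ^+ d + K by rewrite addr_ge0.
have [C1 C10 HC1] := weak_type_heat d p1 KK0 T0.
have [C2 C20 HC2] := inv_weight_le s.
have mF : measurable_fun setT F.
  apply: measurable_funM; first exact: measurable_enorm_powR.
  exact: (measurableT_comp (measurable_powR 1) mw).
have F0 x : 0 <= F x by rewrite mulr_ge0 ?powR_ge0.
exists (2 * (C2 * C1)) => [|t x t0 tT]; first by rewrite !mulr_ge0.
have mh : cmeasurable setT (heat_integrand t f x).
  have mk : measurable_fun setT (fun y : euclid R d => heat_kernel t (vsub x y)).
    under eq_fun do rewrite heat_kernel_sym.
    by apply: measurable_funM => //; exact: measurable_gaussian.
  exact: cmeasurable_mulr.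
have bound : (\int[lebE]_y (normc (heat_integrand t f x y))%:E <=
    (C2 * C1 * t `^ (- (d%:R / (2 * p0))) * expR (l1norm x))%:E)%E.
  pose e1 y := expR (l1norm (vsub y x)) * heat_kernel t (vsub y x).
  have e10 y : 0 <= e1 y by rewrite mulr_ge0 ?expR_ge0 ?heat_kernel_ge0.
  have me1 : measurable_fun setT e1.
    apply: measurable_funM.
      by apply: measurableT_comp => //; exact: measurable_l1norm_vsub.
    by apply: measurable_funM => //; exact: measurable_gaussian.
  apply: (@le_trans _ _ (\int[lebE]_y ((C2 * expR (l1norm x))%:E * (F y * e1 y)%:E))%E).
    apply: ae_ge0_le_integral => //.
    - by move=> y _; rewrite lee_fin normc_ge0.
    - by apply/measurable_EFinP; exact: measurable_normc.
    - move=> y _; rewrite -EFinM lee_fin; apply: mulr_ge0; last exact: mulr_ge0.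
      by rewrite mulr_ge0 ?expR_ge0.
    - by apply: measurable_funeM; apply/measurable_EFinP; exact: measurable_funM.
    apply: filterS (enorm_neq0_ae R d_gt0) => y y0 _.
    rewrite -EFinM lee_fin /heat_integrand normc_real ?heat_kernel_ge0//.
    rewrite -/(vsub x y) heat_kernel_sym (normc_wabs s f y0).
    have hw : enorm y `^ (- s) * wabs s f y <= C2 * expR (l1norm y) * F y.
      rewrite /F powRr1 ?wabs_ge0//.
      move: (wabs_ge0 s f y) (HC2 y); move: (wabs s f y) => w w0 h.
      by rewrite mulrA ler_wpM2r// -mulrA.
    apply: (le_trans (ler_wpM2l (heat_kernel_ge0 _ _) hw)).
    have hl : expR (l1norm y) <= expR (l1norm x) * expR (l1norm (vsub y x)).
      by rewrite -expRD ler_expR (le_trans (l1norm_le_sub x y))// l1norm_sym.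
    rewrite /e1; set hk := heat_kernel _ _.
    have -> : hk * (C2 * expR (l1norm y) * F y) = (C2 * F y * hk) * expR (l1norm y) by ring.
    have -> : C2 * expR (l1norm x) * (F y * (expR (l1norm (vsub y x)) * hk)) =
      (C2 * F y * hk) * (expR (l1norm x) * expR (l1norm (vsub y x))) by ring.
    apply: ler_wpM2l => //; apply: mulr_ge0; first exact: mulr_ge0.
    exact: heat_kernel_ge0.
  rewrite ge0_integralZl//; last 3 first.
  - by apply/measurable_EFinP; exact: measurable_funM.
  - by move=> y _; rewrite lee_fin mulr_ge0.
  - by rewrite lee_fin mulr_ge0 ?expR_ge0.
  apply: (le_trans (lee_wpmul2l _ (HC1 F mF F0 wF t x t0 tT))).
    by rewrite lee_fin mulr_ge0 ?expR_ge0.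
  by rewrite -EFinM lee_fin le_eqVlt; apply/orP; left; apply/eqP; ring.
have ih : cintegrable lebE setT (heat_integrand t f x).
  by apply: cintegrable_bounded => //; rewrite (le_lt_trans bound)// ltry.
rewrite -lee_fin; apply: (le_trans (normc_cintegral_le measurableT ih)).
apply: (le_trans (lee_wpmul2l _ bound)) => //.
by rewrite -EFinM lee_fin le_eqVlt; apply/orP; left; apply/eqP; ring.
Qed.

End weighted.

Lemma powR_add_le (R : realType) (m a b : R) : 0 <= m -> 0 <= a -> 0 <= b ->
  (a + b) `^ m <= 2 `^ m * (a `^ m + b `^ m).
Proof.
move=> m0; wlog ab : a b / a <= b.
  move=> H a0 b0; have [ab|/ltW ba] := leP a b; first exact: H.
  by rewrite (addrC a) (addrC (a `^ m)); exact: H.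
move=> a0 b0; apply: (@le_trans _ _ ((2 * b) `^ m)).
  by apply: ge0_ler_powR => //; rewrite ?nnegrE ?addr_ge0 ?mulr_ge0//; lra.
by rewrite powRM// ler_wpM2l ?powR_ge0// lerDr powR_ge0.
Qed.

(** * Time-integrable bounds for the nonlinearity *)

Section nonlinear_bound.
Context (R : realType) (d : nat) (d_gt0 : (0 < d)%N).
Local Notation lebE := (lebesgue_euclid d).

Lemma weight_powR (s g m : R) (f : euclid R d -> R[i]) x : enorm x != 0 ->
  enorm x `^ g * normc (f x) `^ m = enorm x `^ (- (s * m - g)) * wabs s f x `^ m.
Proof.
move=> x0; rewrite /wabs powRM ?powR_ge0 ?normc_ge0// -powRrM mulrA -powRD.
  by rewrite opprB subrK.
by rewrite x0 implybT.
Qed.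

(** The term 1 accounts for v and the singular term for h; since c < 1, the bound is integrable up
    to t = 0. The constants precede t and u, so one pair serves almost all times and both
    solutions. *)
Lemma nonlinearity_integral_bound (T gamma alpha q s iQ r0 M : R) (r : \bar R)
    (u0 : euclid R d -> R[i]) :
    0 < T -> 1 < alpha -> alpha <= q -> 0 < iQ < 1 -> s / d%:R + q^-1 = iQ ->
    alpha * iQ = 1 + gamma / d%:R -> 0 <= s * (alpha - 1) - gamma ->
    0 <= s * alpha - gamma -> (0 < r)%E -> 0 < r0 -> r0 < alpha -> 0 <= M ->
    wlorentz s q%:E r u0 ->
  exists C c, [/\ 0 <= C, 0 < c < 1 & forall t u, 0 < t -> t <= T ->
    cmeasurable setT u -> cmeasurable setT (fun x => u x - heat t u0 x) ->
    (wlorentz_norm s q%:E r u <= M%:E)%E ->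
    (wlorentz_norm s q%:E r0%:E (fun x => (u x - heat t u0 x)%R) <= M%:E)%E ->
    (\int[lebE]_x (expR (- l1norm x) * (enorm x `^ gamma * normc (u x) `^ alpha))%:E
       <= (C * (1 + t `^ (- c)))%:E)%E].
Proof.
move=> T0 a1 aq /andP[iQ0 iQ1] sq aQ k1_ge0 k_ge0 r_gt0 r00 r0a M0 u0_in.
have dR : 0 < d%:R :> R by rewrite ltr0n.
have a0 := lt_trans ltr01 a1; have q0 := lt_le_trans a0 aq.
(* The reciprocal of the exponent [p0] of [heat_growth]: it is 1/Q_c for s >= 0 and 1/q otherwise,
   below 1 in both cases. *)
pose ip := Num.max s 0 / d%:R + q^-1.
have ip0 : 0 < ip.
  by apply: ltr_wpDl; rewrite ?invr_gt0// divr_ge0// le_max lexx orbT.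
have ip1 : ip < 1.
  rewrite /ip; have [s0|s0] := leP 0 s; first by rewrite sq.
  by rewrite mul0r add0r invf_lt1// (lt_le_trans a1).
have p01 : 1 < ip^-1 by rewrite invf_gt1.
have [C1 C10 HC1] := heat_growth d_gt0 T0 q0 r_gt0 p01 (invrK ip) u0_in.
pose k1 := d%:R / (2 * ip^-1).
have k10 : 0 < k1 by rewrite divr_gt0// mulr_gt0// invr_gt0.
(* Lowering the exponent to [alpha - e] makes the integrand locally integrable; the
   remaining power [e] is paid by the sup bound, of order [t `^ (- k1)], and
   [k1 * e < 1]. *)
pose e := (2 * (k1 + 1))^-1.
have e0 : 0 < e by rewrite invr_gt0 mulr_gt0// addr_gt0.
have e12 : e <= 2^-1.
  by rewrite lef_pV2 ?posrE ?mulr_gt0 ?addr_gt0// ler_pMr// lerDr ltW.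
pose c := k1 * e.
have c0 : 0 < c by rewrite mulr_gt0.
have c1 : c < 1.
  rewrite /c /e ltr_pdivrMr ?mulr_gt0 ?addr_gt0// mul1r; move: k10; lra.
(* The power of |x| left over when |h|^(alpha-e) is expressed by |x|^s |h|. For s >= 0 its sign
   follows from that of s (alpha - 1) - gamma because e <= 1, for s < 0 from that of s alpha -
   gamma. *)
pose k2 := s * alpha - gamma - s * e.
have k20 : 0 <= k2.
  rewrite /k2; have [s0|s0] := leP 0 s.
    have h1 : s * e <= s by rewrite ler_piMr// (le_trans e12)// invf_le1// ler1n.
    move: k1_ge0 h1; rewrite mulrBr mulr1; lra.
  have h1 : s * e <= 0 by rewrite nmulr_rle0// ltW.
  by rewrite subr_ge0 (le_trans h1).
pose m := alpha - e.
have m0 : 0 < m by rewrite /m subr_gt0 (le_lt_trans e12)// (lt_trans _ a1)// invf_lt1// ltr1n.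
(* The weak exponent of |x|^gamma |h|^(alpha-e) has this reciprocal. It would be exactly 1 for e =
   0, where [weak_type_integral] fails. *)
pose ip2 := 1 - e * iQ.
have ip20 : 0 < ip2.
  rewrite /ip2 subr_gt0; apply: lt_trans iQ1; rewrite gtr_pMl//.
  by apply: le_lt_trans e12 _; rewrite invf_lt1// ltr1n.
have ip21 : ip2 < 1 by rewrite /ip2 ltrBlDr ltrDl mulr_gt0.
have p21 : 1 < ip2^-1 by rewrite -[ltLHS]invr1 ltf_pV2 ?posrE.
have p20 := lt_trans ltr01 p21.
have ip2E : ip2 = k2 / d%:R + m / q.
  have -> : ip2 = alpha * (s / d%:R + q^-1) - gamma / d%:R - e * (s / d%:R + q^-1).
    by rewrite sq aQ addrK.
  by rewrite /k2 /m; field; rewrite !gt_eqF.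
have kE : (s * alpha - gamma) / d%:R = 1 - alpha / q.
  have -> : 1 - alpha / q = alpha * (s / d%:R + q^-1) - gamma / d%:R - alpha / q.
    by rewrite sq aQ addrK.
  by field; rewrite !gt_eqF.
have [Ku Ku0 HKu] := @wlorentz_weak_type R d s q r M q0 r_gt0 M0.
have [Kv Kv0 HKv] := @wlorentz_weak_type R d s q r0%:E M q0 r00 M0.
pose Kh := 2 `^ q * (Ku + Kv).
have Kh0 : 0 <= 2 ^+ d + Kh by rewrite !addr_ge0// mulr_ge0 ?powR_ge0 ?addr_ge0.
have [Cv Cv0 HCv] := critical_integral d_gt0 r00 r0a (ltW a1) aq k_ge0 kE M0.
(* Truncation at level 1; the first term is the integral of exp(- |x|_1 / 2). *)
pose B := (2 / 2^-1) ^+ d + weak_const ip2^-1 * (2 ^+ d + Kh) * 1 `^ (1 - ip2^-1).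
have B0 : 0 <= B.
  apply: addr_ge0; first by rewrite exprn_ge0.
  by apply: mulr_ge0; [apply: mulr_ge0 => //; exact: weak_const_ge0|exact: powR_ge0].
pose A := C1 `^ e.
have A0 : 0 <= A by exact: powR_ge0.
exists (2 `^ alpha * (Cv + A * B)), c; split; last 1 first.
  move=> t u t0 tT mu_ mv uM vM.
  pose h := heat t u0; pose v x := u x - h x.
  (* Measurability of h is also read off from u - v, so the only property of the heat flow used here
     is its pointwise bound. *)
  have hE : h = fun x => u x - v x by apply/funext => x; rewrite /v opprB addrC subrK.
  have mh : cmeasurable setT h by rewrite hE; exact: cmeasurable_sub.
  have wh : weak_type lebE q Kh (wabs s h).
    rewrite hE; apply: weak_type_sub => //; first exact: HKu.
    exact: HKv.
  have mwh := measurable_wabs s mh.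
  pose Fh x := enorm x `^ (- k2) * wabs s h x `^ m.
  have wF : weak_type lebE ip2^-1 (2 ^+ d + Kh) Fh.
    by apply: weak_type_enorm_mul wh => //; [rewrite invrK|exact: wabs_ge0].
  have mFh : measurable_fun setT Fh.
    apply: measurable_funM; first exact: measurable_enorm_powR.
    exact: (measurableT_comp (measurable_powR m) mwh).
  have Fh0 x : 0 <= Fh x by rewrite mulr_ge0 ?powR_ge0.
  (* Half of the weight exp(- |x|_1) is kept for integrability; the other half pays for the growth
     exp(e |x|_1) of |h|^e, as e <= 1/2. *)
  pose k (x : euclid R d) : R := expR (- (2^-1 * l1norm x)).
  have mk : measurable_fun setT k.
    apply: measurableT_comp => //; apply: measurableT_comp => //.
    by apply: measurable_funM => //; exact: measurable_l1norm.
  have k01 x : 0 <= k x <= 1.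
    by rewrite expR_ge0/= -[leRHS]expR0 ler_expR oppr_le0 mulr_ge0 ?l1norm_ge0.
  have Fhk : (\int[lebE]_x (Fh x * k x)%:E <= B%:E)%E.
    apply: (le_trans (weak_type_integral p21 Kh0 ltr01 mFh Fh0 mk k01 wF)).
    by rewrite mul1e integral_exp_l1norm ?invr_gt0// -EFinD.
  have mwv := measurable_wabs s mv.
  pose Gv x := enorm x `^ (- (s * alpha - gamma)) * wabs s v x `^ alpha.
  have mGv : measurable_fun setT Gv.
    apply: measurable_funM; first exact: measurable_enorm_powR.
    exact: (measurableT_comp (measurable_powR alpha) mwv).
  have Gv0 x : 0 <= Gv x by rewrite mulr_ge0 ?powR_ge0.
  have Gvi : (\int[lebE]_x (Gv x)%:E <= Cv%:E)%E.
    have := HCv (fun x => (enorm x `^ s)%:C%C * v x) (cmeasurable_weight s mv) vM.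
    apply: le_trans; rewrite le_eqVlt; apply/orP; left; apply/eqP.
    by apply: eq_integral => x _; rewrite /Gv normc_real ?powR_ge0.
  have tc0 : 0 <= A * t `^ (- c) by rewrite mulr_ge0 ?powR_ge0.
  have pt x : enorm x != 0 ->
      expR (- l1norm x) * (enorm x `^ gamma * normc (u x) `^ alpha) <=
      2 `^ alpha * (Gv x + A * t `^ (- c) * (Fh x * k x)).
    move=> x0.
    have u_le : normc (u x) `^ alpha <= 2 `^ alpha * (normc (v x) `^ alpha + normc (h x) `^ alpha).
      apply: le_trans (powR_add_le (ltW a0) (normc_ge0 _) (normc_ge0 _)).
      apply: ge0_ler_powR; rewrite ?nnegrE ?addr_ge0 ?normc_ge0 ?(ltW a0)//.
      by apply: le_trans (le_normcD _ _); rewrite /v subrK.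
    apply: (@le_trans _ _ (expR (- l1norm x) * (enorm x `^ gamma *
        (2 `^ alpha * (normc (v x) `^ alpha + normc (h x) `^ alpha))))).
      by rewrite ler_wpM2l ?expR_ge0// ler_wpM2l ?powR_ge0.
    have -> : expR (- l1norm x) * (enorm x `^ gamma *
        (2 `^ alpha * (normc (v x) `^ alpha + normc (h x) `^ alpha))) =
      2 `^ alpha * (expR (- l1norm x) * (enorm x `^ gamma * normc (v x) `^ alpha) +
        expR (- l1norm x) * (enorm x `^ gamma * normc (h x) `^ alpha)) by ring.
    rewrite ler_wpM2l ?powR_ge0//; apply: lerD.
      rewrite (weight_powR s _ _ _ x0); apply: ler_piMl; first exact: Gv0.
      by rewrite -[leRHS]expR0 ler_expR oppr_le0 l1norm_ge0.
    have -> : normc (h x) `^ alpha = normc (h x) `^ e * normc (h x) `^ m.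
      rewrite -powRD ?/m; first by rewrite addrC subrK.
      by rewrite addrC subrK gt_eqF.
    have -> : expR (- l1norm x) * (enorm x `^ gamma * (normc (h x) `^ e * normc (h x) `^ m)) =
        (expR (- l1norm x) * normc (h x) `^ e) * (enorm x `^ gamma * normc (h x) `^ m) by ring.
    rewrite (weight_powR s _ _ _ x0).
    have -> : s * m - gamma = k2 by rewrite /m /k2; ring.
    rewrite -/(Fh x).
    have -> : A * t `^ (- c) * (Fh x * k x) = (A * t `^ (- c) * k x) * Fh x by ring.
    rewrite ler_wpM2r//.
    have he : normc (h x) `^ e <= A * t `^ (- c) * expR (e * l1norm x).
      have := @ge0_ler_powR _ e (ltW e0) _ _ _ _ (HC1 t x t0 tT).
      rewrite !nnegrE normc_ge0 !mulr_ge0 ?powR_ge0 ?expR_ge0// => /(_ isT isT)/le_trans; apply.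
      rewrite powRM ?mulr_ge0 ?powR_ge0 ?expR_ge0// powRM ?powR_ge0//.
      by rewrite -powRrM mulNr -expRM -/k1 -/c -/A (mulrC (l1norm x)).
    apply: (le_trans (ler_wpM2l (expR_ge0 _) he)).
    rewrite mulrCA ler_wpM2l// -expRD ler_expR.
    rewrite -(opprK (- l1norm x + _)) lerN2 opprD opprK -[X in X - _]mul1r -mulrBl.
    rewrite ler_wpM2r ?l1norm_ge0//; move: e12; lra.
  apply: (@le_trans _ _ (\int[lebE]_x ((2 `^ alpha)%:E *
      ((Gv x)%:E + (A * t `^ (- c))%:E * (Fh x * k x)%:E)))%E).
    apply: ae_ge0_le_integral => //.
    - by move=> x _; rewrite lee_fin !mulr_ge0 ?expR_ge0 ?powR_ge0.
    - apply/measurable_EFinP; apply: measurable_funM.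
        by apply: measurableT_comp => //; apply: measurableT_comp => //; exact: measurable_l1norm.
      apply: measurable_funM; first exact: measurable_enorm_powR.
      exact: (measurableT_comp (measurable_powR alpha) (measurable_normc measurableT mu_)).
    - move=> x _; apply: mule_ge0; first by rewrite lee_fin powR_ge0.
      apply: adde_ge0; first by rewrite lee_fin.
      by apply: mule_ge0; rewrite lee_fin// mulr_ge0//; case/andP: (k01 x).
    - apply: measurable_funeM; apply: emeasurable_funD; first exact/measurable_EFinP.
      by apply: measurable_funeM; apply/measurable_EFinP; exact: measurable_funM.
    apply: filterS (enorm_neq0_ae R d_gt0) => x x0 _.
    by have := pt x x0; rewrite -lee_fin.
  have Fk0 x : (0 <= (Fh x * k x)%:E)%E.
    by rewrite lee_fin mulr_ge0//; case/andP: (k01 x).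
  have mFk : measurable_fun setT (fun x => (Fh x * k x)%:E).
    by apply/measurable_EFinP; exact: measurable_funM.
  have mGvE : measurable_fun setT (fun x => (Gv x)%:E) by exact/measurable_EFinP.
  have mcF : measurable_fun setT (fun x => (A * t `^ (- c))%:E * (Fh x * k x)%:E)%E.
    exact: measurable_funeM.
  have cF0 x : (0 <= (A * t `^ (- c))%:E * (Fh x * k x)%:E)%E.
    by apply: mule_ge0 => //; rewrite lee_fin.
  have msum := emeasurable_funD mGvE mcF.
  have sum0 x : (0 <= (Gv x)%:E + (A * t `^ (- c))%:E * (Fh x * k x)%:E)%E.
    by apply: adde_ge0 => //; rewrite lee_fin.
  rewrite ge0_integralZl// ge0_integralD//; last by move=> x _; rewrite lee_fin.
  rewrite ge0_integralZl ?lee_fin//.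
  apply: (@le_trans _ _ ((2 `^ alpha)%:E * (Cv%:E + (A * t `^ (- c))%:E * B%:E))%E).
    rewrite lee_wpmul2l ?lee_fin ?powR_ge0// leeD//.
    by rewrite lee_wpmul2l ?lee_fin.
  have tp : 0 <= t `^ (- c) by exact: powR_ge0.
  have AB : 0 <= A * B by exact: mulr_ge0.
  suff : 2 `^ alpha * (Cv + A * t `^ (- c) * B) <=
      2 `^ alpha * (Cv + A * B) * (1 + t `^ (- c)) by rewrite -lee_fin.
  rewrite -[leRHS]mulrA ler_wpM2l ?powR_ge0//.
  rewrite -subr_ge0 (_ : _ - _ = Cv * t `^ (- c) + A * B); last by ring.
  by rewrite addr_ge0// mulr_ge0.
- by apply: mulr_ge0; [exact: powR_ge0|rewrite addr_ge0// mulr_ge0].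
- by rewrite c0.
Qed.

(** The essential supremum refers to Lebesgue measure restricted to ]0, T[, whose null sets are
    Lebesgue null once intersected with that interval. The maximum with 0 covers the formal value
    -oo. *)
Lemma Linfty_wlorentz_bound (T s q : R) (r : \bar R) (u : R -> euclid R d -> R[i]) :
  Linfty_wlorentz T s q%:E r u ->
  exists2 M, 0 <= M & \forall t \ae @lebesgue_measure R, t \in `]0, T[ ->
    cmeasurable setT (u t) /\ (wlorentz_norm s q%:E r (u t) <= M%:E)%E.
Proof.
move=> [_ uae ess].
set E := ess_sup _ _ in ess.
exists (Num.max 0 (fine E)) => [|]; first by rewrite le_max lexx.
have EM : (E <= (Num.max 0 (fine E))%:E)%E.
  move: ess; case: E => [e| |]//= _; last by rewrite leNye.
  by rewrite lee_fin le_max lexx orbT.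
have h : \forall t \ae @lebesgue_measure R, t \in `]0, T[ ->
    (wlorentz_norm s q%:E r (u t) <= E)%E.
  have [N [mN N0 PN]] := ess_sup_ge (mrestr (@lebesgue_measure R) (measurable_itv `]0%R, T[))
    (fun t => wlorentz_norm s q%:E r (u t)).
  exists (N `&` `]0, T[); split => //; first by apply: measurableI.
  move=> t /= nH; split.
    by apply: PN => /= H; apply: nH.
  by apply: contrapT => nt; apply: nH => t'; exfalso; apply: nt.
apply: ae_imp (ae_and uae h) => t [h1 h2] tT; split; first by case: (h1 tT).
exact: le_trans (h2 tT) EM.
Qed.

End nonlinear_bound.

(** * The space-time kernel and uniqueness *)

Section spacetime.
Context (R : realType) (d : nat).
Local Notation lebE := (lebesgue_euclid d).
Local Notation leb := (@lebesgue_measure R).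
Local Notation Z := (measurableTypeR R * euclid R d)%type.

Definition causal : set (Z * Z) := [set w | 0 < w.2.1 /\ w.2.1 < w.1.1].

(* The factor 4 is the loss from [normc z <= `|Re z| + `|Im z|], which is used once
   for the space integral and once for the time integral. *)
Definition causal_heat (w : Z * Z) : R :=
  4 * \1_causal w * heat_kernel (w.1.1 - w.2.1) (vsub w.1.2 w.2.2).

Lemma measurable_time1 : measurable_fun setT (fun w : Z * Z => w.1.1).
Proof. exact: measurableT_comp. Qed.

Lemma measurable_time2 : measurable_fun setT (fun w : Z * Z => w.2.1).
Proof. exact: measurableT_comp. Qed.

Lemma measurable_causal : measurable causal.
Proof.
rewrite (_ : causal = [set w | 0 < w.2.1] `&` [set w | 0 < w.1.1 - w.2.1]).
  apply: measurableI.
    exact: (measurable_gt_fun (F := fun w : Z * Z => w.2.1) 0 measurable_time2).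
  apply: (measurable_gt_fun (F := fun w : Z * Z => w.1.1 - w.2.1)).
  by apply: measurable_funB; [exact: measurable_time1|exact: measurable_time2].
by apply/seteqP; split => w /=; rewrite /causal/= subr_gt0.
Qed.

Lemma causal_heat_ge0 w : 0 <= causal_heat w.
Proof.
by apply: mulr_ge0; [rewrite mulr_ge0// indicE ler0n|exact: heat_kernel_ge0].
Qed.

Lemma measurable_causal_heat : measurable_fun setT causal_heat.
Proof.
pose th (w : Z * Z) : R := w.1.1 - w.2.1.
have mth : measurable_fun setT th.
  by apply: measurable_funB; [exact: measurable_time1|exact: measurable_time2].
(* The division by 4 th becomes a power -1, a measurable function on the whole line. The two agree
   for th > 0, and elsewhere the indicator vanishes. *)
rewrite (_ : causal_heat = fun w => 4 * \1_causal w * ((4 * pi * th w) `^ (- (d%:R / 2)) *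
    expR (- (\sum_(i < d) (tnth w.1.2 i - tnth w.2.2 i) ^+ 2) * (4 * th w) `^ (-1)))).
  apply: measurable_funM.
    apply: measurable_funM => //; apply: measurable_indic; exact: measurable_causal.
  apply: measurable_funM.
    by apply: (measurableT_comp (measurable_powR _)); exact: measurable_funM.
  apply: measurableT_comp => //; apply: measurable_funM; last first.
    by apply: (measurableT_comp (measurable_powR _)); exact: measurable_funM.
  apply: measurableT_comp => //; apply: measurable_sum => i.
  apply: measurable_funX; apply: measurable_funB.
    have mx : measurable_fun setT (fun w : Z * Z => w.1.2) by exact: measurableT_comp.
    exact: (measurableT_comp (@measurable_coord R d i) mx).
  have mx : measurable_fun setT (fun w : Z * Z => w.2.2) by exact: measurableT_comp.
  exact: (measurableT_comp (@measurable_coord R d i) mx).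
apply/funext => w; rewrite /causal_heat indicE.
case: (boolP (w \in causal)); last by rewrite mulr0 !mul0r.
rewrite inE => -[_ wt]; have t0 : 0 < th w by rewrite subr_gt0.
congr (_ * (_ * expR _)); rewrite enorm_sqr powR_inv1; last by rewrite mulr_ge0// ltW.
by congr (- _ / _); apply: eq_bigr => i _; rewrite tnth_vsub.
Qed.

Definition spacetime_weight (Lam : R) (z : Z) : R :=
  expR (- (Lam * z.1)) * expR (- l1norm z.2).

Lemma spacetime_weight_gt0 Lam z : 0 < spacetime_weight Lam z.
Proof. by rewrite mulr_gt0 ?expR_gt0. Qed.

Lemma measurable_spacetime_weight Lam : measurable_fun setT (spacetime_weight Lam).
Proof.
apply: measurable_funM; apply: measurableT_comp => //; apply: measurableT_comp => //.
  by apply: measurable_funM => //; exact: measurable_fst.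
by apply: measurableT_comp; [exact: measurable_l1norm|exact: measurable_snd].
Qed.

Lemma expRN_le_powRN (eta x : R) : 0 < eta -> eta <= 1 -> 0 < x ->
  expR (- x) <= x `^ (- eta).
Proof.
move=> e0 e1 x0; rewrite expRN powRN lef_pV2 ?posrE ?expR_gt0 ?powR_gt0//.
apply: (le_trans (powR_le_expR e0 (ltW x0))).
rewrite ler_piMl ?expR_ge0// -[leRHS](powRr0 eta) ger_powR ?e0//; exact: ltW.
Qed.

(** The column bound for the Schur test. In space exp(- |x|_1) <= exp(- |y|_1) exp |x - y|_1 and the
    hypothesis on W apply; in time, the decay of exp(- Lam t) from tau to t provides the smallness.
    The exceptional times lie in the variable of integration, so the conclusion holds for every
    z'. *)
Lemma causal_schur (T a C : R) (W : Z -> R) : 0 < T -> 0 < a -> a < 1 -> 0 <= C ->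
    measurable_fun setT W -> (forall z, 0 <= W z) ->
    (forall z, z.1 \notin `]0, T[ -> W z = 0) ->
    (\forall t \ae leb, t \in `]0, T[ -> forall th y, 0 < th -> th <= T ->
       (\int[lebE]_x (W (t, x) * (expR (l1norm (vsub x y)) * heat_kernel th (vsub x y)))%:E
         <= (C * th `^ (- a))%:E)%E) ->
  exists2 Lam, 0 < Lam & forall z',
    (\int[leb \x lebE]_z (spacetime_weight Lam z * W z * causal_heat (z, z'))%:E <=
     (spacetime_weight Lam z' / 2)%:E)%E.
Proof.
move=> T0 a0 a1 C0 mW W0 Wout Wb.
(* Half of the gap below 1, so that [a + eta] is still an integrable singularity. *)
pose eta := (1 - a) / 2.
have eta0 : 0 < eta by rewrite divr_gt0// subr_gt0.
have eta1 : eta <= 1 by rewrite /eta; lra.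
have c0 : 0 < a + eta by rewrite addr_gt0.
have c1 : a + eta < 1 by rewrite /eta; lra.
have [C4 C40 HC4] := singular_integral_bound c0 c1 T0.
(* Chosen so that 4 C C4 / D <= 1/2; the summand 1 keeps it positive when the constants vanish. *)
pose D := 8 * C * C4 + 1.
have D0 : 0 < D by rewrite ltr_wpDl// !mulr_ge0.
(* [expR (- Lam * th) <= (Lam * th) `^ (- eta)] gains a small factor for large [Lam]
   while [th `^ (- (a + eta))] stays integrable. *)
pose Lam := D `^ eta^-1.
have Lam0 : 0 < Lam by exact: powR_gt0.
have LamE : Lam `^ (- eta) = D^-1.
  by rewrite -powRrM mulrN mulVf ?gt_eqF// powR_inv1// ltW.
exists Lam => // -[tau y].
set rho' := spacetime_weight Lam (tau, y).
have rho'0 : 0 <= rho' by rewrite ltW// spacetime_weight_gt0.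
pose H (z : Z) : \bar R := (spacetime_weight Lam z * W z * causal_heat (z, (tau, y)))%:E.
have mrho := measurable_spacetime_weight Lam.
have mk : measurable_fun setT (fun z => causal_heat (z, (tau, y))).
  exact: (measurable_fun_pair1 (tau, y) measurable_causal_heat).
have mH : measurable_fun setT H.
  by apply/measurable_EFinP; apply: measurable_funM => //; exact: measurable_funM.
have H0 z : (0 <= H z)%E.
  rewrite lee_fin; apply: mulr_ge0; last exact: causal_heat_ge0.
  by apply: mulr_ge0 => //; exact/ltW/spacetime_weight_gt0.
rewrite (_ : (\int[_]_z _ = \int[leb \x lebE]_z H z)%E)// fubini_tonelli1//.
pose G (t : R) : \bar R :=
  ((rho' * (4 * C * D^-1))%:E * (`|t - tau| `^ (- (a + eta)))%:E)%E.
have G0 t : (0 <= G t)%E.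
  by rewrite lee_fin !mulr_ge0 ?powR_ge0// invr_ge0 ltW.
have mG : measurable_fun setT G.
  apply: measurable_funeM; apply/measurable_EFinP.
  apply: (measurableT_comp (measurable_powR _)) => //.
  by apply: measurableT_comp => //; exact: measurable_funB.
apply: (@le_trans _ _ (\int[leb]_(t in `]0%R, T[) G t)%E); last first.
  rewrite ge0_integralZl//; last 2 first.
  - apply/measurable_EFinP; apply: measurable_funTS.
    apply: (measurableT_comp (measurable_powR _)) => //.
    by apply: measurableT_comp => //; exact: measurable_funB.
  - by rewrite lee_fin !mulr_ge0// invr_ge0 ltW.
  apply: (le_trans (lee_wpmul2l _ (HC4 tau))).
    by rewrite lee_fin !mulr_ge0// invr_ge0 ltW.
  rewrite -EFinM lee_fin -[leLHS]mulrA ler_wpM2l//.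
  rewrite mulrAC ler_pdivrMr// /D; lra.
rewrite [leRHS]integral_mkcond.
apply: ae_ge0_le_integral => //.
- by move=> t _; apply: integral_ge0.
- exact: (measurable_fun_fubini_tonelli_F (m2 := lebE) H mH H0).
- by move=> t _; rewrite patchE; case: ifP.
- by apply/(measurable_restrictT _ _).1 => //; exact: measurable_funTS.
apply: ae_imp Wb => t Wt _; rewrite patchE; case: ifPn; last first.
  move=> tn; rewrite /fubini_F (eq_integral (fun=> 0%E)) ?integral0// => x _.
  rewrite /H Wout ?mulr0 ?mul0r//; apply/negP => tT; move/negP: tn; apply.
  by rewrite inE/=.
rewrite inE/= => tT; have {}Wt := Wt tT.
have zero : (tau, y) \in [set z : Z | ~ (0 < z.1 /\ z.1 < t)] ->
    (fubini_F lebE H t <= G t)%E.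
  rewrite inE/= => ntau; rewrite /fubini_F (eq_integral (fun=> 0%E)) ?integral0// => x _.
  by rewrite /H /causal_heat indicE memNset ?mulr0 ?mul0r ?mulr0.
have [tau0|tau0] := ltP 0 tau; last first.
  by apply: zero; rewrite inE/= => -[h _]; move: (lt_le_trans h tau0); rewrite ltxx.
have [taut|taut] := ltP tau t; last first.
  by apply: zero; rewrite inE/= => -[_ h]; move: (lt_le_trans h taut); rewrite ltxx.
have {zero} t0T : 0 < t < T by move: tT; rewrite in_itv.
pose th := t - tau.
have th0 : 0 < th by rewrite subr_gt0.
have thT : th <= T by move: t0T tau0; rewrite /th; lra.
pose K x := W (t, x) * (expR (l1norm (vsub x y)) * heat_kernel th (vsub x y)).
have mWt : measurable_fun setT (fun x => W (t, x)) by exact: (measurable_fun_pair2 t mW).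
have mK : measurable_fun setT K.
  apply: measurable_funM => //; apply: measurable_funM.
    by apply: measurableT_comp => //; exact: measurable_l1norm_vsub.
  by apply: measurable_funM => //; exact: measurable_gaussian.
have K0 x : 0 <= K x.
  apply: mulr_ge0 => //; apply: mulr_ge0; first exact: expR_ge0.
  exact: heat_kernel_ge0.
pose e1 := 4 * expR (- (Lam * t)) * expR (- l1norm y).
have e10 : 0 <= e1 by rewrite !mulr_ge0 ?expR_ge0.
apply: (@le_trans _ _ (\int[lebE]_x (e1%:E * (K x)%:E))%E).
  apply: ge0_le_integral => //.
  - exact: (measurable_fun_pair2 t mH).
  - by apply: measurable_funeM; exact/measurable_EFinP.
  move=> x _; rewrite /H -EFinM lee_fin /causal_heat indicE mem_set ?mulr1//=.
  rewrite /spacetime_weight/= /K /e1 -/th.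
  have hl : expR (- l1norm x) <= expR (- l1norm y) * expR (l1norm (vsub x y)).
    by rewrite -expRD ler_expR; have := l1norm_le_sub x y; lra.
  move: (W0 (t, x)) (heat_kernel_ge0 th (vsub x y)) hl.
  move: (W (t, x)) (heat_kernel th _) (expR (- l1norm x)) (expR (- l1norm y))
    (expR (l1norm _)) => w h A B E w0 h0 hl.
  have -> : expR (- (Lam * t)) * A * w * (4 * h) = 4 * expR (- (Lam * t)) * w * h * A by ring.
  have -> : 4 * expR (- (Lam * t)) * B * (w * (E * h)) =
    4 * expR (- (Lam * t)) * w * h * (B * E) by ring.
  by rewrite ler_wpM2l// !mulr_ge0 ?expR_ge0.
have mKE : measurable_fun setT (fun x => (K x)%:E) by exact/measurable_EFinP.
have K0E x : setT x -> (0 <= (K x)%:E)%E by rewrite lee_fin.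
have e10E : (0 <= e1%:E)%E by rewrite lee_fin.
rewrite (ge0_integralZl lebE measurableT mKE K0E e10E).
apply: (le_trans (lee_wpmul2l _ (Wt th y th0 thT))); first by rewrite lee_fin.
rewrite /G -!EFinM lee_fin.
have -> : `|t - tau| = th by rewrite gtr0_norm.
have hexp : expR (- (Lam * t)) <= expR (- (Lam * tau)) * (D^-1 * th `^ (- eta)).
  have -> : - (Lam * t) = - (Lam * tau) + - (Lam * th) by rewrite /th; ring.
  rewrite expRD ler_wpM2l ?expR_ge0// -LamE -powRM ?(ltW Lam0) ?(ltW th0)//.
  by apply: expRN_le_powRN => //; rewrite mulr_gt0.
have -> : th `^ (- (a + eta)) = th `^ (- a) * th `^ (- eta).
  by rewrite opprD powRD// (gt_eqF th0) implybT.
rewrite /e1 /rho' /spacetime_weight/=.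
have p1 : 0 <= th `^ (- a) by exact: powR_ge0.
have p2 : 0 <= expR (- l1norm y) by exact: expR_ge0.
have -> : 4 * expR (- (Lam * t)) * expR (- l1norm y) * (C * th `^ (- a)) =
  (4 * expR (- l1norm y) * C * th `^ (- a)) * expR (- (Lam * t)) by ring.
have -> : expR (- (Lam * tau)) * expR (- l1norm y) * (4 * C / D) *
    (th `^ (- a) * th `^ (- eta)) =
  (4 * expR (- l1norm y) * C * th `^ (- a)) * (expR (- (Lam * tau)) * (D^-1 * th `^ (- eta))) by ring.
by rewrite ler_wpM2l// !mulr_ge0.
Qed.

End spacetime.

Notation spacetime R d := (measurableTypeR R * euclid R d)%type.

(** * The difference of two Duhamel terms *)

Section difference.
Context (R : realType) (d : nat) (T gamma alpha : R) (u1 u2 : R -> euclid R d -> R[i]).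
Local Notation lebE := (lebesgue_euclid d).
Local Notation leb := (@lebesgue_measure R).
Local Notation Z := (measurableTypeR R * euclid R d)%type.
Local Notation strip := (`]0%R, T[ `*` [set: euclid R d] : set Z).

Lemma measurable_strip : measurable strip.
Proof. by apply: measurableX => //; exact: measurable_itv. Qed.

Lemma cmeasurable_nonlinearity (u : R -> euclid R d -> R[i]) :
  cmeasurable strip (fun z : Z => u z.1 z.2) ->
  cmeasurable strip (fun z : Z => nonlinearity gamma alpha (u z.1) z.2).
Proof.
move=> mu; apply: (cmeasurable_mulr (g := fun z : Z =>
  enorm z.2 `^ gamma * normc (u z.1 z.2) `^ (alpha - 1))) => //.
apply: measurable_funM.
  apply: measurable_funTS.
  by apply: (measurableT_comp (measurable_enorm_powR gamma)); exact: measurable_snd.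
apply: (measurableT_comp (measurable_powR _)).
exact: (measurable_normc measurable_strip mu).
Qed.

(** Extended by 0 outside the strip, since measurability of the solutions is only given inside
    it. *)
Definition nonlinearity_gap : Z -> R :=
  (fun z => normc (nonlinearity gamma alpha (u1 z.1) z.2
                   - nonlinearity gamma alpha (u2 z.1) z.2)) \_ strip.

Lemma nonlinearity_gap_ge0 z : 0 <= nonlinearity_gap z.
Proof. by rewrite /nonlinearity_gap patchE; case: ifP => // _; exact: normc_ge0. Qed.

Lemma nonlinearity_gapE t x : 0 < t < T -> nonlinearity_gap (t, x) =
  normc (nonlinearity gamma alpha (u1 t) x - nonlinearity gamma alpha (u2 t) x).
Proof.
by move=> tT; rewrite /nonlinearity_gap patchE mem_set//; split => //=; rewrite in_itv.
Qed.

Lemma measurable_nonlinearity_gap :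
  cmeasurable strip (fun z : Z => u1 z.1 z.2) ->
  cmeasurable strip (fun z : Z => u2 z.1 z.2) ->
  measurable_fun setT nonlinearity_gap.
Proof.
move=> m1 m2; apply/(measurable_restrictT _ _).1; first exact: measurable_strip.
apply: (measurable_normc measurable_strip).
by apply: cmeasurable_sub; exact: cmeasurable_nonlinearity.
Qed.

(** The [duhamel_defined] clauses make both the time and the space integral additive, so the
    subtraction can be carried under each of them before moduli are taken. Tonelli then reads the
    iterated integral as one over space-time. *)
Lemma duhamel_sub_le t x : 0 < t < T -> measurable_fun setT nonlinearity_gap ->
    duhamel_defined gamma alpha u1 t x -> duhamel_defined gamma alpha u2 t x ->
  ((normc (duhamel gamma alpha u1 t x - duhamel gamma alpha u2 t x))%:E <=
   \int[leb \x lebE]_z (causal_heat ((t, x) : Z, z) * nonlinearity_gap z)%:E)%E.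
Proof.
move=> /andP[t0 tT] mF [h1 i1] [h2 i2].
pose f u tau := heat (t - tau) (nonlinearity gamma alpha (u tau)) x.
have mt : measurable (`]0%R, t[%classic : set (measurableTypeR R)) by exact: measurable_itv.
have i12 := cintegrable_sub mt i1 i2.
rewrite /duhamel -(cintegral_sub mt i1 i2).
apply: (le_trans (normc_cintegral_le mt i12)).
pose H (z : Z) : \bar R := (causal_heat ((t, x), z) * nonlinearity_gap z)%:E.
have mH : measurable_fun setT H.
  apply/measurable_EFinP; apply: measurable_funM => //.
  exact: (measurable_fun_pair2 ((t, x) : Z) (@measurable_causal_heat R d)).
have H0 z : (0 <= H z)%E.
  by rewrite lee_fin mulr_ge0 ?causal_heat_ge0 ?nonlinearity_gap_ge0.
rewrite [leRHS](_ : _ = \int[leb \x lebE]_z H z)%E// fubini_tonelli1//.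
have mG := measurable_fun_fubini_tonelli_F (m2 := lebE) H mH H0.
have G0 tau : (0 <= fubini_F lebE H tau)%E by exact: integral_ge0.
apply: (@le_trans _ _ (\int[leb]_(tau in `]0%R, t[) fubini_F lebE H tau)%E); last first.
  by apply: ge0_subset_integral => //; exact: measurable_itv.
have mN : measurable_fun (`]0%R, t[%classic : set (measurableTypeR R))
    (fun tau => (normc (f u1 tau - f u2 tau))%:E).
  by apply/measurable_EFinP; apply: (measurable_normc mt); exact: (cintegrable_measurable i12).
rewrite -ge0_integralZl//; last by move=> tau _; rewrite lee_fin normc_ge0.
apply: ae_ge0_le_integral => //.
- by move=> tau _; rewrite mule_ge0 ?lee_fin ?normc_ge0.
- exact: measurable_funeM.
- exact: measurable_funTS.
apply: ae_imp (ae_and h1 h2) => tau [d1 d2] /= tau_t.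
have {}d1 := d1 tau_t; have {}d2 := d2 tau_t.
move: tau_t; rewrite in_itv/= => /andP[tau0 taut].
apply: (@le_trans _ _ (2%:E * (normc (cintegral lebE setT (fun y =>
    heat_integrand (t - tau) (nonlinearity gamma alpha (u1 tau)) x y -
    heat_integrand (t - tau) (nonlinearity gamma alpha (u2 tau)) x y)%R))%:E)%E).
  by rewrite (cintegral_sub measurableT d1 d2) lexx.
apply: (le_trans (lee_wpmul2l _ (normc_cintegral_le measurableT
  (cintegrable_sub measurableT d1 d2)))) => //.
rewrite muleA -EFinM /fubini_F.
have mgap : measurable_fun setT (fun y => (normc (heat_integrand (t - tau) (nonlinearity gamma alpha (u1 tau)) x y -
    heat_integrand (t - tau) (nonlinearity gamma alpha (u2 tau)) x y))%:E).
  apply/measurable_EFinP; apply: measurable_normc => //.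
  apply: (cintegrable_measurable (mu := lebE)) => //.
  exact: cintegrable_sub.
rewrite -ge0_integralZl//; last by move=> y _; rewrite lee_fin normc_ge0.
rewrite le_eqVlt; apply/orP; left; apply/eqP; apply: eq_integral => y _.
rewrite /H nonlinearity_gapE ?tau0 ?(lt_trans taut)//.
rewrite /causal_heat indicE mem_set// mulr1 -EFinM; congr EFin.
rewrite /heat_integrand -mulrBr normc_real ?heat_kernel_ge0// -/(vsub x y) /=.
by rewrite mulrA; congr (_ * _ * _); ring.
Qed.

End difference.

(** For finite r, r (alpha - 1)/(r - 1) < alpha clears to alpha < r; for r = +oo the conjugate is 1
    and the value is alpha - 1. *)
Lemma hoelder_conjugate_bound (R : realType) (alpha : R) (r : \bar R) :
  1 < alpha -> (alpha%:E < r)%E -> exists r0 : R,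
  [/\ (hoelder_conjugate r * (alpha - 1)%:E)%E = r0%:E, 0 < r0 & r0 < alpha].
Proof.
move=> a1; have a0 := lt_trans ltr01 a1.
have b0 : 0 < alpha - 1 by rewrite subr_gt0.
case: r => [r| |]//; last first.
  move=> _; exists (alpha - 1); split => //; last by rewrite ltrBlDr ltrDl.
  by rewrite hoelder_conjugatey mul1e.
rewrite lte_fin => ar; have r1 := lt_trans a1 ar; have r0 := lt_trans a0 ar.
have r10 : 0 < r - 1 by rewrite subr_gt0.
exists (r / (r - 1) * (alpha - 1)); split.
- rewrite /hoelder_conjugate /= eqe gt_eqF// -EFinB inver gt_eqF//.
- by rewrite !mulr_gt0 ?invr_gt0.
- rewrite mulrAC ltr_pdivrMr//; move: ar; lra.
Qed.

Lemma lebesgue_point_ae (R : realType) (a : R) :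
  \forall t \ae @lebesgue_measure R, t != a.
Proof.
exists [set a]; split => //; first exact: lebesgue_measure_set1.
by move=> t /= /negP; rewrite negbK => /eqP.
Qed.

Lemma nonlinearity_normc (R : realType) (d : nat) (gamma alpha : R)
    (f : euclid R d -> R[i]) x : 0 < alpha ->
  normc (nonlinearity gamma alpha f x) = enorm x `^ gamma * normc (f x) `^ alpha.
Proof.
move=> a0; rewrite /nonlinearity normc_real ?mulr_ge0 ?powR_ge0// -mulrA.
by rewrite (mulrC (_ `^ (alpha - 1))) mulr_powRB1 ?normc_ge0.
Qed.

Lemma nonlinearity_sub_le (R : realType) (d n : nat) (gamma alpha s : R)
    (f g : euclid R d -> R[i]) x : 1 < alpha -> alpha - 1 <= n%:R -> enorm x != 0 ->
  normc (nonlinearity gamma alpha f x - nonlinearity gamma alpha g x) <=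
  (n%:R + 1) * (enorm x `^ (- (s * (alpha - 1) - gamma)) * wabs s f x `^ (alpha - 1) +
    enorm x `^ (- (s * (alpha - 1) - gamma)) * wabs s g x `^ (alpha - 1)) *
  normc (f x - g x).
Proof.
move=> a1 an x0.
rewrite -(weight_powR s gamma (alpha - 1) f x0) -(weight_powR s gamma (alpha - 1) g x0).
rewrite -mulrDr.
have -> : nonlinearity gamma alpha f x - nonlinearity gamma alpha g x =
    (enorm x `^ gamma)%:C%C * ((normc (f x) `^ (alpha - 1))%:C%C * f x -
      (normc (g x) `^ (alpha - 1))%:C%C * g x).
  by rewrite /nonlinearity !rmorphM/=; ring.
rewrite normc_real ?powR_ge0//.
have b0 : 0 < alpha - 1 by rewrite subr_gt0.
apply: (le_trans (ler_wpM2l (powR_ge0 _ _) (normc_power_diff (f x) (g x) b0 an))).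
by rewrite le_eqVlt; apply/orP; left; apply/eqP; ring.
Qed.

Theorem proposition1p5 (R : realType) (d : nat) (T gamma alpha q s : R)
    (r : \bar R) (u0 : euclid R d -> R[i]) (u1 u2 : R -> euclid R d -> R[i])
    (T_gt0 : 0 < T)
    (d_gt0 : (0 < d)%N)
    (gamma_gt : - Num.min 2 d%:R < gamma)
    (alpha_gt : Num.max 1 (1 + gamma / d%:R) < alpha)
    (alpha_le_q : alpha <= q)
    (s_ge : gamma / (alpha - 1) <= s)
    (s_lt : s < d%:R)
    (alpha_lt_star : (alpha%:E < alpha_star d gamma)%E)
    (alpha_lt_r : (alpha%:E < r)%E)
    (scaling : s / d%:R + q^-1 = (Q_crit d gamma alpha)^-1)
    (subcritical : (Q_crit d gamma alpha)^-1 < (q_crit d gamma alpha)^-1)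
    (u0_in : wlorentz s q%:E r u0)
    (u1_mild : mild_solution gamma alpha T s q%:E r u0 u1)
    (u2_mild : mild_solution gamma alpha T s q%:E r u0 u2)
    (u1_aux : Linfty_wlorentz T s q%:E (hoelder_conjugate r * (alpha - 1)%:E)%E
      (fun t x => u1 t x - heat t u0 x))
    (u2_aux : Linfty_wlorentz T s q%:E (hoelder_conjugate r * (alpha - 1)%:E)%E
      (fun t x => u2 t x - heat t u0 x)) :
  \forall t \ae @lebesgue_measure R, t \in `[0, T] ->
    \forall x \ae lebesgue_euclid d, u1 t x = u2 t x.
Proof.
have a1 : 1 < alpha by move: alpha_gt; rewrite gt_max => /andP[].
have [iQ [iQ01 sq a_lt1 aQ [k1_ge0 k_ge0]]] :=
  exponent_arithmetic d_gt0 gamma_gt alpha_gt alpha_le_q s_ge scaling subcritical.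
have [r0 [r0E r00 r0a]] := hoelder_conjugate_bound a1 alpha_lt_r.
rewrite r0E in u1_aux u2_aux.
have a0 := lt_trans ltr01 a1; have q0 := lt_le_trans a0 alpha_le_q.
have b0 : 0 < alpha - 1 by rewrite subr_gt0.
have dR : 0 < d%:R :> R by rewrite ltr0n.
have r_gt0 : (0 < r)%E by apply: lt_trans alpha_lt_r; rewrite lte_fin.
have [u1_in u1_eq] := u1_mild; have [u2_in u2_eq] := u2_mild.
have [M1 M10 HM1] := Linfty_wlorentz_bound u1_in.
have [M2 M20 HM2] := Linfty_wlorentz_bound u2_in.
have [M3 M30 HM3] := Linfty_wlorentz_bound u1_aux.
have [M4 M40 HM4] := Linfty_wlorentz_bound u2_aux.
pose M := M1 + M2 + M3 + M4.
have M0 : 0 <= M by rewrite !addr_ge0.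
have [M1M M2M M3M M4M] : [/\ M1 <= M, M2 <= M, M3 <= M & M4 <= M].
  by rewrite /M; clear -M10 M20 M30 M40; split; lra.
have /andP[iQ0 iQ1] := iQ01.
pose mu : {sigma_finite_measure set (spacetime R d) -> \bar R} :=
  product_sigma_finite_measure (@lebesgue_measure R) (lebesgue_euclid d).
have [m1 _ _] := u1_in; have [m2 _ _] := u2_in.
pose F := nonlinearity_gap T gamma alpha u1 u2.
have mF : measurable_fun setT F by exact: measurable_nonlinearity_gap.
have F0 z : 0 <= F z by exact: nonlinearity_gap_ge0.
(* [W] dominates the difference quotient of the nonlinearity. *)
pose k1 := s * (alpha - 1) - gamma.
pose V (f : euclid R d -> R[i]) (x : euclid R d) : R :=
  enorm x `^ (- k1) * wabs s f x `^ (alpha - 1).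
(* An integer above alpha - 1, as [normc_power_diff] asks. *)
pose n := Num.bound (alpha - 1).
have bn : alpha - 1 <= n%:R by rewrite ltW// archi_boundP// ltW.
pose W : spacetime R d -> R :=
  (fun z : spacetime R d => (n%:R + 1) * (V (u1 z.1) z.2 + V (u2 z.1) z.2)) \_ (`]0%R, T[ `*` [set: euclid R d]).
have V0 f x : 0 <= V f x by rewrite mulr_ge0 ?powR_ge0.
have W0 z : 0 <= W z.
  by rewrite /W patchE; case: ifP => // _; rewrite mulr_ge0 ?addr_ge0.
have WE t x : 0 < t < T -> W (t, x) = (n%:R + 1) * (V (u1 t) x + V (u2 t) x).
  by move=> tT; rewrite /W patchE mem_set//; split => //=; rewrite in_itv.
have Wout z : z.1 \notin `]0, T[ -> W z = 0.
  by move=> zT; rewrite /W patchE memNset// => -[/= h _]; move: zT; rewrite h.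
have mstrip := @measurable_strip R d T.
have mW : measurable_fun setT W.
  have mV (u : R -> euclid R d -> R[i]) :
      cmeasurable (`]0%R, T[ `*` [set: euclid R d]) (fun z : spacetime R d => u z.1 z.2) ->
      measurable_fun (`]0%R, T[ `*` [set: euclid R d] : set (spacetime R d)) (fun z : spacetime R d => V (u z.1) z.2).
    move=> mu'; apply: measurable_funM.
      apply: measurable_funTS.
      by apply: (measurableT_comp (measurable_enorm_powR (- k1))); exact: measurable_snd.
    apply: (measurableT_comp (measurable_powR _)); apply: measurable_funM.
      apply: measurable_funTS.
      by apply: (measurableT_comp (measurable_enorm_powR s)); exact: measurable_snd.
    exact: (measurable_normc mstrip mu').
  apply/(measurable_restrictT _ _).1 => //; apply: measurable_funM => //.
  by apply: measurable_funD; exact: mV.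
pose ip := 1 - iQ.
have ip0 : 0 < ip by rewrite subr_gt0.
have p1 : 1 < ip^-1 by rewrite -[ltLHS]invr1 ltf_pV2 ?posrE// ltrBlDr ltrDl.
have p0 := lt_trans ltr01 p1.
have ipE : (ip^-1)^-1 = k1 / d%:R + (alpha - 1) / q.
  rewrite invrK; have -> : ip = alpha * (s / d%:R + q^-1) - gamma / d%:R - (s / d%:R + q^-1).
    by rewrite sq aQ addrK.
  by rewrite /k1; field; rewrite !gt_eqF.
have [K K0 HK] := @wlorentz_weak_type R d s q r M q0 r_gt0 M0.
have KK0 : 0 <= 2 ^+ d + K by rewrite addr_ge0.
have [C C0 HC] := weak_type_heat d p1 KK0 T_gt0.
pose a := d%:R / (2 * ip^-1).
have aE : a = d%:R / 2 * (1 - iQ) by rewrite /a -/ip; field; rewrite gt_eqF.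
have a_gt0 : 0 < a by rewrite divr_gt0// mulr_gt0.
have a_lt : a < 1 by rewrite aE.
have CC0 : 0 <= (n%:R + 1) * (C + C) by rewrite mulr_ge0 ?addr_ge0.
have HV f : cmeasurable setT f -> (wlorentz_norm s q%:E r f <= M%:E)%E ->
    forall th y, 0 < th -> th <= T ->
    (\int[lebesgue_euclid d]_x (V f x * (expR (l1norm (vsub x y)) * heat_kernel th (vsub x y)))%:E
      <= (C * th `^ (- a))%:E)%E.
  move=> mf fM; apply: HC.
  - apply: measurable_funM; first exact: measurable_enorm_powR.
    exact: (measurableT_comp (measurable_powR _) (measurable_wabs s mf)).
  - by [].
  - apply: (weak_type_enorm_mul d_gt0 k1_ge0 b0 q0 p0 ipE).
    + exact: measurable_wabs.
    + exact: wabs_ge0.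
    + exact: HK.
have Wb : \forall t \ae @lebesgue_measure R, t \in `]0, T[ -> forall th y, 0 < th -> th <= T ->
    (\int[lebesgue_euclid d]_x (W (t, x) * (expR (l1norm (vsub x y)) * heat_kernel th (vsub x y)))%:E
      <= ((n%:R + 1) * (C + C) * th `^ (- a))%:E)%E.
  apply: ae_imp (ae_and HM1 HM2) => t [h1 h2] tT th y th0 thT.
  have [mu1 b1] := h1 tT; have [mu2 b2] := h2 tT.
  have tT' : 0 < t < T by move: tT; rewrite in_itv.
  pose e1 x := expR (l1norm (vsub x y)) * heat_kernel th (vsub x y).
  have me1 : measurable_fun setT e1.
    apply: measurable_funM.
      by apply: measurableT_comp => //; exact: measurable_l1norm_vsub.
    by apply: measurable_funM => //; exact: measurable_gaussian.
  have e10 x : 0 <= e1 x by rewrite mulr_ge0 ?expR_ge0 ?heat_kernel_ge0.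
  have mVe f : cmeasurable setT f -> measurable_fun setT (fun x => (V f x * e1 x)%:E).
    move=> mf; apply/measurable_EFinP; apply: measurable_funM => //.
    apply: measurable_funM; first exact: measurable_enorm_powR.
    exact: (measurableT_comp (measurable_powR _) (measurable_wabs s mf)).
  have Ve0 f x : (0 <= (V f x * e1 x)%:E)%E by rewrite lee_fin mulr_ge0.
  rewrite (eq_integral (fun x => (n%:R + 1)%:E *
      ((V (u1 t) x * e1 x)%:E + (V (u2 t) x * e1 x)%:E))%E); last first.
    move=> x _; rewrite WE//.
    rewrite -[RHS]/(((n%:R + 1) * (V (u1 t) x * e1 x + V (u2 t) x * e1 x))%:E).
    by rewrite -/(e1 x); congr EFin; ring.
  have n10 : (0 <= (n%:R + 1 : R)%:E)%E by rewrite lee_fin addr_ge0.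
  have s0 x : setT x -> (0 <= (V (u1 t) x * e1 x)%:E + (V (u2 t) x * e1 x)%:E)%E.
    by move=> _; exact: adde_ge0.
  rewrite (ge0_integralZl (lebesgue_euclid d) measurableT (emeasurable_funD (mVe _ mu1) (mVe _ mu2)) s0 n10).
  rewrite ge0_integralD//; [|exact: mVe|exact: mVe].
  rewrite -mulrA EFinM lee_wpmul2l// mulrDl EFinD leeD//.
    by apply: HV => //; apply: (le_trans b1); rewrite lee_fin.
  by apply: HV => //; apply: (le_trans b2); rewrite lee_fin.
have [Lam Lam0 HLam] := causal_schur T_gt0 a_gt0 a_lt CC0 mW W0 Wout Wb.
have mild : \forall z \ae mu, z.1 \in `]0, T[ ->
    ((normc (u1 z.1 z.2 - u2 z.1 z.2))%:E <=
     \int[mu]_z' (causal_heat (z, z') * F z')%:E)%E.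
  apply: ae_imp (ae_and u1_eq u2_eq) => -[t x] /= [e1 e2] tT.
  have [_ d1 ->] := e1 tT; have [_ d2 ->] := e2 tT.
  rewrite opprD addrACA subrr add0r.
  by apply: duhamel_sub_le => //; move: tT; rewrite in_itv.
have F_le : \forall z \ae mu,
    ((F z)%:E <= (W z)%:E * \int[mu]_z' (causal_heat (z, z') * F z')%:E)%E.
  have x0 := ae_prod_snd (@lebesgue_measure R) (enorm_neq0_ae R d_gt0).
  apply: ae_imp (ae_and mild x0) => -[t x] /= [ml xn0].
  have I0 : (0 <= \int[mu]_z' (causal_heat ((t, x), z') * F z')%:E)%E.
    by apply: integral_ge0 => z' _; rewrite lee_fin mulr_ge0 ?causal_heat_ge0.
  have [tT|tT] := boolP (t \in `]0, T[); last first.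
    rewrite /F /nonlinearity_gap patchE memNset; last by move=> -[/= h _]; move: tT; rewrite h.
    by rewrite mule_ge0// lee_fin.
  have tT' : 0 < t < T by move: tT; rewrite in_itv.
  apply: le_trans (lee_wpmul2l _ (ml tT)); last by rewrite lee_fin.
  rewrite -EFinM lee_fin WE// /F nonlinearity_gapE//.
  exact: nonlinearity_sub_le.
have F_fin : (\int[mu]_z (spacetime_weight Lam z * F z)%:E < +oo)%E.
  have [A [c [A0 /andP[c0 c1] HA]]] := nonlinearity_integral_bound d_gt0 T_gt0 a1
    alpha_le_q iQ01 sq aQ k1_ge0 k_ge0 r_gt0 r00 r0a M0 u0_in.
  have [B B0 HB] := singular_integral_bound c0 c1 T_gt0.
  pose H (z : spacetime R d) : \bar R := (spacetime_weight Lam z * F z)%:E.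
  have mH : measurable_fun setT H.
    apply/measurable_EFinP; apply: measurable_funM => //.
    exact: measurable_spacetime_weight.
  have H0 z : (0 <= H z)%E by rewrite lee_fin mulr_ge0// ltW// spacetime_weight_gt0.
  rewrite (_ : (\int[_]_z _ = \int[@lebesgue_measure R \x lebesgue_euclid d]_z H z)%E)// fubini_tonelli1//.
  (* [A] occurs twice, once for each solution; [t - 0] matches [singular_integral_bound] at
     [tau = 0]. *)
  pose G (t : R) : \bar R := ((2 * A)%:E * (1 + (`|t - 0| `^ (- c))%:E))%E.
  have mP : measurable_fun setT (fun t : R => (`|t - 0| `^ (- c))%:E).
    apply/measurable_EFinP; apply: (measurableT_comp (measurable_powR _)) => //.
    by apply: measurableT_comp => //; exact: measurable_funB.
  have mG : measurable_fun setT G.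
    by apply: measurable_funeM; exact: emeasurable_funD.
  have A20 : (0 <= (2 * A)%:E)%E by rewrite lee_fin mulr_ge0.
  have P0 t : (0 <= (`|t - 0| `^ (- c))%:E)%E by rewrite lee_fin powR_ge0.
  have G0 t : (0 <= G t)%E by rewrite mule_ge0// adde_ge0.
  apply: (@le_lt_trans _ _ (\int[@lebesgue_measure R]_(t in `]0%R, T[) G t)%E); last first.
    rewrite ge0_integralZl//; last 2 first.
    - by apply: measurable_funTS; exact: emeasurable_funD.
    - by move=> t _; exact: adde_ge0.
    rewrite ge0_integralD//; last exact: measurable_funTS.
    rewrite lte_mul_pinfty// lte_add_pinfty//; last by rewrite (le_lt_trans (HB 0))// ltry.
    by rewrite integral_cst// mul1e [ltLHS](lebesgue_measure_oo (ltW T_gt0)) ltry.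
  rewrite [leRHS]integral_mkcond.
  apply: ae_ge0_le_integral => //.
  - by move=> t _; apply: integral_ge0.
  - exact: (measurable_fun_fubini_tonelli_F (m2 := lebesgue_euclid d) H mH H0).
  - by move=> t _; rewrite patchE; case: ifP.
  - by apply/(measurable_restrictT _ _).1 => //; exact: measurable_funTS.
  apply: ae_imp (ae_and (ae_and HM1 HM2) (ae_and HM3 HM4)) => t [[h1 h2] [h3 h4]] _.
  rewrite patchE; case: ifPn => [|tn]; last first.
    rewrite /fubini_F (eq_integral (fun=> 0%E)) ?integral0// => x _.
    rewrite /H /F /nonlinearity_gap patchE memNset ?mulr0// => -[/= tT _].
    by move/negP: tn; apply; rewrite inE.
  rewrite inE/= => tT; have tT' : 0 < t < T by move: tT; rewrite in_itv.
  have /andP[t0 t1] := tT'.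
  have [mu1 b1] := h1 tT; have [mu2 b2] := h2 tT.
  have [mv1 b3] := h3 tT; have [mv2 b4] := h4 tT.
  pose N (u : R -> euclid R d -> R[i]) x : R :=
    expR (- l1norm x) * (enorm x `^ gamma * normc (u t x) `^ alpha).
  have N0 u x : (0 <= (N u x)%:E)%E by rewrite lee_fin !mulr_ge0 ?expR_ge0 ?powR_ge0.
  have mN u : cmeasurable setT (u t) -> measurable_fun setT (fun x => (N u x)%:E).
    move=> mu'; apply/measurable_EFinP; apply: measurable_funM.
      by apply: measurableT_comp => //; apply: measurableT_comp => //; exact: measurable_l1norm.
    apply: measurable_funM; first exact: measurable_enorm_powR.
    exact: (measurableT_comp (measurable_powR alpha) (measurable_normc measurableT mu')).
  have le_M (c1' : R) (X : \bar R) : c1' <= M -> (X <= c1'%:E)%E -> (X <= M%:E)%E.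
    by move=> cM /le_trans; apply; rewrite lee_fin.
  apply: (@le_trans _ _ (\int[lebesgue_euclid d]_x ((N u1 x)%:E + (N u2 x)%:E))%E).
    apply: ge0_le_integral => //.
    - exact: (measurable_fun_pair2 t mH).
    - by apply: emeasurable_funD; exact: mN.
    move=> x _; rewrite /H -EFinD lee_fin /spacetime_weight/= /F nonlinearity_gapE//.
    have e1 : expR (- (Lam * t)) <= 1.
      by rewrite -[leRHS]expR0 ler_expR oppr_le0 mulr_ge0// ltW.
    rewrite -mulrA; apply: (@le_trans _ _ (1 * (expR (- l1norm x) *
      normc (nonlinearity gamma alpha (u1 t) x - nonlinearity gamma alpha (u2 t) x)))).
      by rewrite ler_wpM2r// mulr_ge0 ?expR_ge0 ?normc_ge0.
    rewrite mul1r /N -mulrDr ler_wpM2l ?expR_ge0//.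
    by apply: (le_trans (le_normcD _ _)); rewrite normcN !nonlinearity_normc.
  rewrite ge0_integralD//; [|exact: mN|exact: mN].
  have hA1 := HA t (u1 t) t0 (ltW t1) mu1 mv1 (le_M _ _ M1M b1) (le_M _ _ M3M b3).
  have hA2 := HA t (u2 t) t0 (ltW t1) mu2 mv2 (le_M _ _ M2M b2) (le_M _ _ M4M b4).
  apply: (le_trans (leeD hA1 hA2)).
  rewrite /G subr0 gtr0_norm// -EFinD -EFinD -EFinM lee_fin.
  by rewrite le_eqVlt; apply/orP; left; apply/eqP; ring.
have Fz : \forall z \ae mu, F z = 0.
  apply: (schur_vanish mF mW (measurable_spacetime_weight Lam)
    (@measurable_causal_heat R d) F0 W0 _ _ F_le HLam F_fin).
  - by move=> z; exact: spacetime_weight_gt0.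
  - by move=> z; exact: causal_heat_ge0.
(* F = 0 says only that the nonlinear terms agree; Duhamel's formula then returns the equality of
   the solutions. *)
have u_eq : \forall z \ae mu, z.1 \in `]0, T[ -> u1 z.1 z.2 = u2 z.1 z.2.
  apply: ae_imp mild => z ml zT; apply/eqP; rewrite -subr_eq0; apply/eqP.
  apply: eq0_normc; apply/eqP; rewrite eq_le normc_ge0 andbT -lee_fin.
  apply: (le_trans (ml zT)).
  rewrite (ge0_ae_eq_integral (g := fun=> 0%E)) ?integral0//.
  - apply/measurable_EFinP; apply: measurable_funM => //.
    exact: (measurable_fun_pair2 z (@measurable_causal_heat R d)).
  - by move=> z' _; rewrite lee_fin mulr_ge0 ?causal_heat_ge0.
  by apply: ae_imp Fz => z' Fz' _; rewrite Fz' mulr0.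
have u_sec := ae_prod_sections u_eq.
(* The equation is known on the open interval; the two endpoints form a null set of times. *)
have ends := ae_and (lebesgue_point_ae (0 : R)) (lebesgue_point_ae T).
apply: ae_imp (ae_and ends u_sec) => t [[t0 tT] h] tin.
have tT' : t \in `]0, T[.
  by move: tin; rewrite !in_itv/= !le_eqVlt eq_sym (negbTE t0) (negbTE tT).
by apply: ae_imp h => x; exact.
Qed.
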